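(* Let $(u_n)_{n\geq1}$ be a computable sequence of functions $[0,1]\to\mathbb{R}$ which is computably Lipschitz, i.e. there is a computable sequence $(\ell_n)_{n\geq1}$ of (positive) rationals such that $u_n$ is $\ell_n$-Lipschitz for every $n\geq1$. Let $x\in[0,1]$. (a) If the sequence $(u_n(x))_{n\geq1}$ is $\Sigma^0_1$-u.d., then $x$ is Martin-Löf random. (b) If the sequence $(u_n(x))_{n\geq1}$ is Schnorr $\Sigma^0_1$-u.d., then $x$ is Schnorr random.
   Context: $\lambda$ denotes Lebesgue measure. A real $r$ is computable if there is a computable sequence of rationals $(q_k)_{k}$ with $|r-q_k|\leq 2^{-k}$ for all $k$; a sequence of reals is computable if this holds uniformly. A sequence $(f_n)_{n\geq1}$ of functions $[0,1]\to\mathbb{R}$ is computable if (in the usual sense of computable analysis) there is an algorithm which, given $n$, $k$ and oracle access to any sequence of rationals converging to $t\in[0,1]$ with error at most $2^{-j}$ at step $j$, outputs a rational within $2^{-k}$ of $f_n(t)$. For $\ell>0$, a function $f:[0,1]\to\mathbb{R}$ is $\ell$-Lipschitz if $|f(s)-f(t)|\leq\ell|s-t|$ for all $s,t\in[0,1]$. Randomness. A Martin-Löf test is a sequence $(U_n)_{n\in\mathbb{N}}$ of decreasing open sets $U_n=\bigcup_{k\in\mathbb{N}} I_{n,k}$, where $(I_{n,k})_{n,k\in\mathbb{N}}$ is a computable sequence of open intervals with rational endpoints, such that the sequence $(\lambda(U_n))_{n\in\mathbb{N}}$ is upper-bounded by a computable function of $n$ which converges to zero. A real passes the test if it is not in all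 the $U_n$'s. A real is Martin-Löf random if it passes every Martin-Löf test. A Schnorr test is a Martin-Löf test such that the sequence of reals $(\lambda(U_n))_{n\in\mathbb{N}}$ is computable; a real is Schnorr random if it passes every Schnorr test. $\Sigma^0_1$ sets. A subset $S$ of $[0,1]$ is $\Sigma^0_1$ if $S=\bigcup_{k\geq1}I_k$ for some computable sequence $(I_k)_{k\geq1}$ of (possibly empty) open intervals with rational endpoints. Uniform distribution relative to a class. Write $\{y\}=y-\lfloor y\rfloor$ for the fractional part of a real $y$. For a class $\mathcal{C}$ of measurable subsets of $[0,1]$, a sequence $(x_n)_{n\geq1}$ of reals is $\mathcal{C}$-u.d. if for every $A\in\mathcal{C}$, $\lim_{N\to\infty}\frac1N\#\{n:1\leq n\leq N,\ \{x_n\}\in A\}=\lambda(A)$. It is $\Sigma^0_1$-u.d. if it is $\mathcal{C}$-u.d. for $\mathcal{C}$ the family of all $\Sigma^0_1$ subsets of $[0,1]$, and Schnorr $\Sigma^0_1$-u.d. if it is $\mathcal{C}$-u.d. for $\mathcal{C}$ the family of $\Sigma^0_1$ subsets of $[0,1]$ having computable Lebesgue measure. *)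

(* Defs.v *)
(* Uses MathComp and MathComp-Analysis, with reals in an arbitrary realType;
   from the standard library only the Cantor pairing function. *)
From Stdlib Require Cantor.
From HB Require Import structures.
From mathcomp Require Import all_boot all_order all_algebra.
From mathcomp Require Import all_classical all_reals all_analysis.
Set Implicit Arguments.
Unset Strict Implicit.
Unset Printing Implicit Defensive.
Import Order.TTheory GRing.Theory Num.Theory.
Import numFieldNormedType.Exports.
Local Open Scope classical_set_scope.
Local Open Scope ring_scope.

Definition npair (m n : nat) : nat := Cantor.to_nat (m, n).
Definition nfst (n : nat) : nat := (Cantor.of_nat n).1.
Definition nsnd (n : nat) : nat := (Cantor.of_nat n).2.

(* Programs for the partial recursive functions with an oracle.  All functions
   are unary: several arguments are packed with the bijection [npair]. *)
Inductive prog : Type :=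
  | Zero
  | Succ
  | Fst
  | Snd
  | Oracle
  | Pair of prog & prog
  | Comp of prog & prog
  | Prec of prog & prog
  | Mu of prog.

(* [F] and [G] are graphs of partial functions f and g; this is the graph of
   h(0) = f(m), h(k+1) = g(m, k, h(k)). *)
Fixpoint prec_graph (F G : nat -> nat -> Prop) (m k r : nat) : Prop :=
  if k is k'.+1 then
    exists2 s : nat, prec_graph F G m k' s & G (npair m (npair k' s)) r
  else F m r.

(* [run phi c n r]: with oracle [phi] and input [n], the program [c] halts
   with output [r]. *)
Fixpoint run (phi : nat -> nat) (c : prog) (n r : nat) : Prop :=
  match c with
  | Zero => r = 0%N
  | Succ => r = n.+1
  | Fst => r = nfst n
  | Snd => r = nsnd n
  | Oracle => r = phi n
  | Pair c1 c2 => exists s t : nat,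
      [/\ run phi c1 n s, run phi c2 n t & r = npair s t]
  | Comp c1 c2 => exists2 s : nat, run phi c2 n s & run phi c1 s r
  | Prec c1 c2 =>
      prec_graph (run phi c1) (run phi c2) (nfst n) (nsnd n) r
  | Mu c1 => run phi c1 (npair n r) 0%N /\
      forall m : nat, (m < r)%N -> exists s : nat, run phi c1 (npair n m) s.+1
  end.

(* The zero oracle gives the unrelativised notion. *)
Definition computable (f : nat -> nat) : Prop :=
  exists c : prog, forall n : nat, run (fun=> 0%N) c n (f n).

(* Surjective, not injective: ((a, b), d) codes (a - b) / (d + 1). *)
Definition rat_of_code (n : nat) : rat :=
  ((nfst (nfst n))%:R - (nsnd (nfst n))%:R) / (nsnd n).+1%:R.

Definition computable_rat_seq (q : nat -> rat) : Prop :=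
  exists2 g : nat -> nat, computable g & forall k, q k = rat_of_code (g k).

Definition computable_rat_seq2 (q : nat -> nat -> rat) : Prop :=
  exists2 g : nat -> nat, computable g &
    forall n k, q n k = rat_of_code (g (npair n k)).

Definition computable_real (R : realType) (r : R) : Prop :=
  exists2 q : nat -> rat, computable_rat_seq q &
    forall k, `|r - ratr (q k)| <= 2 ^- k.

Definition computable_real_seq (R : realType) (r : nat -> R) : Prop :=
  exists2 q : nat -> nat -> rat, computable_rat_seq2 q &
    forall n k, `|r n - ratr (q n k)| <= 2 ^- k.

(* Functions on [0, 1] are total functions on R whose values outside [0, 1]
   are ignored, and the sequence starts at index 1.  A single program must
   work for all n, k, t and all oracles naming t. *)
Definition computable_fun_seq (R : realType) (f : nat -> R -> R) : Prop :=
  exists c : prog,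
    forall (n k : nat) (t : R) (phi : nat -> nat),
      (1 <= n)%N -> t \in `[0, 1] ->
      (forall j, `|t - ratr (rat_of_code (phi j))| <= 2 ^- j) ->
      exists2 v : nat, run phi c (npair n k) v &
        `|f n t - ratr (rat_of_code v)| <= 2 ^- k.

Definition computably_Lipschitz (R : realType) (u : nat -> R -> R) : Prop :=
  exists2 l : nat -> rat, computable_rat_seq l &
    forall n, (1 <= n)%N ->
      0 < l n /\ (ratr (l n)).-lipschitz_(`[0, 1]%classic) (u n).

Definition MartinLof_test (R : realType) (U : nat -> set R) : Prop :=
  [/\ exists a b : nat -> nat -> rat,
        [/\ computable_rat_seq2 a, computable_rat_seq2 b &
          forall n, U n = \bigcup_k `]ratr (a n k), ratr (b n k)[%classic],
      forall n, U n.+1 `<=` U n &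
      exists g : nat -> R,
        [/\ computable_real_seq g,
          forall n, (lebesgue_measure (U n) <= (g n)%:E)%E &
          g n @[n --> \oo] --> (0 : R)]].

(* By the bound in [MartinLof_test] the measures are finite, so [fine] loses
   nothing. *)
Definition Schnorr_test (R : realType) (U : nat -> set R) : Prop :=
  MartinLof_test U /\
  computable_real_seq (fun n => fine (lebesgue_measure (U n))).

Definition passes (R : realType) (x : R) (U : nat -> set R) : Prop :=
  ~ (forall n, U n x).

Definition MartinLof_random (R : realType) (x : R) : Prop :=
  forall U : nat -> set R, MartinLof_test U -> passes x U.

Definition Schnorr_random (R : realType) (x : R) : Prop :=
  forall U : nat -> set R, Schnorr_test U -> passes x U.

(* The intervals are open in the real line (and empty if the right endpoint
   does not exceed the left one). *)
Definition Sigma01 (R : realType) (S : set R) : Prop :=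
  S `<=` `[0, 1]%classic /\
  exists a b : nat -> rat,
    [/\ computable_rat_seq a, computable_rat_seq b &
      S = \bigcup_k `]ratr (a k), ratr (b k)[%classic].

Definition Schnorr_Sigma01 (R : realType) (S : set R) : Prop :=
  Sigma01 S /\ computable_real (fine (lebesgue_measure S)).

Definition frac_part (R : realType) (y : R) : R := y - (Num.floor y)%:~R.

Definition ud (R : realType) (C : set (set R)) (x : nat -> R) : Prop :=
  forall A : set R, C A ->
    ((\sum_(1 <= n < N.+1 | frac_part (x n) \in A) 1)%N%:R / N%:R)%:E @[N --> \oo]
      --> lebesgue_measure A.

(* Main.v *)
(* Suppose x lies in every member of a test. Pass to a computable subsequence W_n
   with lambda(W_n) <= 2^-(n + L_n + 7), where u_(n+1) is 2^(L_n)-Lipschitz, and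
   cut W_n into its maximal dyadic cells. A cell of length 2^-s is mapped by u_(n+1)
   into an interval of length 6 * 2^(L_n - s) about an approximate value at its left
   end. As the cells do not overlap, these intervals taken modulo 1 form a
   Sigma^0_1 set S with lambda(S) <= 1/2 which contains the fractional part of
   every u_n(x) unless this is 0. Comparing the frequencies of S and of (0, 1)
   shows that (u_n(x)) is not uniformly distributed.
   If the measures lambda(W_n) are computable, one can compute how many dyadic
   levels exhaust W_n up to a given error; the image of the other cells has small
   measure, so that lambda(S) is approximated by the measures of computable finite
   subunions and S has computable measure. *)
Require Import Defs.
From Stdlib Require Cantor.
From mathcomp Require Import all_boot all_order all_algebra.
From mathcomp Require Import all_classical all_reals all_analysis.
From mathcomp Require Import zify ring lra.
Set Implicit Arguments.
Unset Strict Implicit.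
Unset Printing Implicit Defensive.
Import Order.TTheory GRing.Theory Num.Theory.
Import numFieldNormedType.Exports.
Local Open Scope classical_set_scope.
Local Open Scope ring_scope.

(** * Computable functions *)

Lemma nfst_pair m n : nfst (npair m n) = m.
Proof. by rewrite /nfst /npair Cantor.cancel_of_to. Qed.

Lemma nsnd_pair m n : nsnd (npair m n) = n.
Proof. by rewrite /nsnd /npair Cantor.cancel_of_to. Qed.

Definition npairE := (nfst_pair, nsnd_pair).

Lemma npairK n : npair (nfst n) (nsnd n) = n.
Proof. by rewrite /nfst /nsnd /npair -surjective_pairing Cantor.cancel_to_of. Qed.

(** Twice the pairing is a polynomial with nonnegative coefficients. Monotonicity lets one code
    bound all codes with smaller entries. *)
Lemma leq_npair m m' n n' :
  (m <= m')%N -> (n <= n')%N -> (npair m n <= npair m' n')%N.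
Proof.
move=> hm hn; have := Cantor.to_nat_spec m n; have := Cantor.to_nat_spec m' n'.
rewrite /npair; move: (Cantor.to_nat _) (Cantor.to_nat _) => p q hp hq.
apply/ssrnat.leP; move/ssrnat.leP: hm => hm; move/ssrnat.leP: hn => hn.
nia.
Qed.

Section Computability.
Local Open Scope nat_scope.

Implicit Types f g h : nat -> nat.

Definition computable2 (F : nat -> nat -> nat) : Prop :=
  computable (fun w => F (nfst w) (nsnd w)).

(** The arguments nest to the right, as in the step function of [Prec]. *)
Definition computable3 (F : nat -> nat -> nat -> nat) : Prop :=
  computable (fun w => F (nfst w) (nfst (nsnd w)) (nsnd (nsnd w))).

Lemma computable_id : computable (fun n => n).
Proof. by exists (Pair Fst Snd) => n /=; do 2 eexists; split=> //; rewrite npairK. Qed.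

Lemma computable_comp f g :
  computable f -> computable g -> computable (fun n => f (g n)).
Proof. by move=> [c hc] [d hd]; exists (Comp c d) => n /=; exists (g n). Qed.

Lemma computable_pair f g :
  computable f -> computable g -> computable (fun n => npair (f n) (g n)).
Proof. by move=> [c hc] [d hd]; exists (Pair c d) => n /=; exists (f n), (g n). Qed.

Lemma computable_nfst f : computable f -> computable (fun n => nfst (f n)).
Proof. by apply: computable_comp; exists Fst. Qed.

Lemma computable_nsnd f : computable f -> computable (fun n => nsnd (f n)).
Proof. by apply: computable_comp; exists Snd. Qed.

Lemma computable_succ f : computable f -> computable (fun n => (f n).+1).
Proof. by apply: computable_comp; exists Succ. Qed.

Lemma computable_const k : computable (fun=> k).
Proof.
elim: k => [|k ih]; first by exists Zero.
exact: computable_succ.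
Qed.

Lemma computable_comp2 F f g :
  computable2 F -> computable f -> computable g ->
  computable (fun n => F (f n) (g n)).
Proof.
move=> hF hf hg; have := computable_comp hF (computable_pair hf hg).
by under eq_fun do rewrite ?npairE.
Qed.

(** Primitive recursion with parameter [n]; the arithmetic below is obtained from it by choosing the
    step. *)
Lemma computable_iteri F f k :
  computable3 F -> computable f -> computable k ->
  computable (fun n => iteri (k n) (F n) (f n)).
Proof.
move=> [c hc] [d hd] hk.
apply: (@computable_comp2 (fun n j => iteri j (F n) (f n))) => //;
  last exact: computable_id.
exists (Prec d c) => w /=; elim: (nsnd w) => [|j ih] /=; first exact: hd.
exists (iteri j (F (nfst w)) (f (nfst w))) => //.
set m := iteri _ _ _; have := hc (npair (nfst w) (npair j m)).
by rewrite ?npairE.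
Qed.

Lemma computable_pred f : computable f -> computable (fun n => (f n).-1).
Proof.
(* The last index handed to the step is the predecessor of the number of steps. *)
move=> hf; have := @computable_iteri (fun _ i _ => i) (fun=> 0) f.
rewrite (_ : (fun n => iteri _ _ _) = fun n => (f n).-1); last first.
  by apply/funext => n; case: (f n).
apply=> //; last exact: computable_const.
by apply: computable_nfst; apply: computable_nsnd; exact: computable_id.
Qed.

Lemma computable_add f g :
  computable f -> computable g -> computable (fun n => f n + g n).
Proof.
move=> hf hg; have := @computable_iteri (fun _ _ r => r.+1) f g.
rewrite (_ : (fun n => iteri _ _ _) = fun n => f n + g n); last first.
  by apply/funext => n; elim: (g n) => [|k /= ->]; rewrite ?addn0 ?addnS.
apply=> //; apply: computable_succ.
by do 2 apply: computable_nsnd; exact: computable_id.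
Qed.

Lemma computable_sub f g :
  computable f -> computable g -> computable (fun n => f n - g n).
Proof.
move=> hf hg; have := @computable_iteri (fun _ _ r => r.-1) f g.
rewrite (_ : (fun n => iteri _ _ _) = fun n => f n - g n); last first.
  by apply/funext => n; elim: (g n) => [|k /= ->]; rewrite ?subn0 ?subnS.
apply=> //; apply: computable_pred.
by do 2 apply: computable_nsnd; exact: computable_id.
Qed.

Lemma computable_sum F k :
  computable2 F -> computable k -> computable (fun n => \sum_(i < k n) F n i).
Proof.
move=> hF hk; have := @computable_iteri (fun n i r => r + F n i) (fun=> 0) k.
rewrite (_ : (fun n => iteri _ _ _) = fun n => \sum_(i < k n) F n i);
  last first.
  apply/funext => n; elim: (k n) => [|j /= ->]; first by rewrite big_ord0.
  by rewrite big_ord_recr.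
have hid := computable_id; apply=> //; last exact: computable_const.
apply: computable_add; first by do 2 apply: computable_nsnd.
apply: computable_comp2 => //; first exact: computable_nfst.
by apply: computable_nfst; exact: computable_nsnd.
Qed.

Lemma computable_mul f g :
  computable f -> computable g -> computable (fun n => f n * g n).
Proof.
move=> hf hg; have := @computable_sum (fun n _ => f n) g.
rewrite (_ : (fun n => \sum_(_ < _) _) = fun n => f n * g n); last first.
  by apply/funext => n; rewrite sum_nat_const card_ord mulnC.
apply=> //; apply: computable_comp => //.
by apply: computable_nfst; exact: computable_id.
Qed.

Lemma computable_expn k f : computable f -> computable (fun n => k ^ f n).
Proof.
move=> hf; have := @computable_iteri (fun _ _ r => k * r) (fun=> 1) f.
rewrite (_ : (fun n => iteri _ _ _) = fun n => k ^ f n); last first.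
  by apply/funext => n; elim: (f n) => [|j /= ->] //; rewrite expnS.
apply=> //; last exact: computable_const.
apply: computable_mul; first exact: computable_const.
by do 2 apply: computable_nsnd; exact: computable_id.
Qed.

Lemma computable_not (p : pred nat) :
  computable p -> computable (fun n => ~~ p n).
Proof.
move=> hp; rewrite (_ : (fun n => _) = fun n => 1 - p n).
  by apply: computable_sub => //; exact: computable_const.
by apply/funext => n; case: (p n).
Qed.

Lemma computable_and (p q : pred nat) :
  computable p -> computable q -> computable (fun n => p n && q n).
Proof.
move=> hp hq; rewrite (_ : (fun n => _) = fun n => p n * q n).
  exact: computable_mul.
by apply/funext => n; rewrite mulnb.
Qed.

Lemma computable_leq f g :
  computable f -> computable g -> computable (fun n => f n <= g n).
Proof.
move=> hf hg; rewrite (_ : (fun n => _) = fun n => 1 - (f n - g n)).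
  by apply: computable_sub; [exact: computable_const|exact: computable_sub].
apply/funext => n; rewrite leqNgt -subn_gt0.
by case: (f n - g n) => // k; rewrite subnS.
Qed.

(** The quotient is the number of positive multiples of the divisor up to the dividend. *)
Lemma computable_divn f g :
  computable f -> computable g -> computable (fun n => f n %/ (g n).+1).
Proof.
move=> hf hg; have hid := computable_id.
have := @computable_sum (fun n k => k.+1 * (g n).+1 <= f n) f.
rewrite (_ : (fun n => \sum_(_ < _) _) = fun n => f n %/ (g n).+1); last first.
  apply/funext => n; set q := _ %/ _.
  have qf : q <= f n by apply: leq_div.
  transitivity (\sum_(i < f n | i < q) 1); last first.
    by rewrite -(big_ord_widen (f n) (fun=> 1)) // sum1_card card_ord.
  by rewrite [RHS]big_mkcond; apply: eq_bigr => i _; rewrite /q leq_divRL //; case: ifP.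
apply=> //; apply: computable_leq.
  apply: computable_mul; first by apply: computable_succ; exact: computable_nsnd.
  by apply: computable_succ; apply: computable_comp => //; exact: computable_nfst.
by apply: computable_comp => //; exact: computable_nfst.
Qed.

Lemma computable_modn f g :
  computable f -> computable g -> computable (fun n => f n %% (g n).+1).
Proof.
move=> hf hg; rewrite (_ : (fun n => _) = fun n => f n - f n %/ (g n).+1 * (g n).+1).
  apply: computable_sub => //; apply: computable_mul; first exact: computable_divn.
  exact: computable_succ.
by apply/funext => n; rewrite {2}(divn_eq (f n) (g n).+1) addKn.
Qed.

(* Replaces the oracle by the first component of the input. *)
Fixpoint oracle_free (c : prog) : prog :=
  match c with
  | Zero => Zero
  | Succ => Comp Succ Snd
  | Fst => Comp Fst Snd
  | Snd => Comp Snd Snd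
  | Oracle => Fst
  | Pair c1 c2 => Pair (oracle_free c1) (oracle_free c2)
  | Comp c1 c2 => Comp (oracle_free c1) (Pair Fst (oracle_free c2))
  | Prec c1 c2 =>
      Comp (Prec (oracle_free c1)
                 (Comp (oracle_free c2)
                       (Pair (Comp Fst Fst) (Pair (Comp Snd Fst) Snd))))
           (Pair (Pair Fst (Comp Fst Snd)) (Comp Snd Snd))
  | Mu c1 =>
      Mu (Comp (oracle_free c1)
               (Pair (Comp Fst Fst) (Pair (Comp Snd Fst) Snd)))
  end.

(** A rational point has a constant name. Carrying this constant along with the input turns a
    computation with that oracle into one that ignores the oracle. *)
Lemma run_oracle_free phi e c n r :
  run (fun=> e) c n r -> run phi (oracle_free c) (npair e n) r.
Proof.
elim: c n r => [||||| c1 ih1 c2 ih2 | c1 ih1 c2 ih2 | c1 ih1 c2 ih2 | c1 ih1]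
  n r /=.
- by [].
- by move=> ->; exists n; rewrite ?npairE.
- by move=> ->; exists n; rewrite ?npairE.
- by move=> ->; exists n; rewrite ?npairE.
- by rewrite npairE.
- by move=> [s [t [/ih1 h1 /ih2 h2 ->]]]; exists s, t.
- move=> [s /ih2 h2 /ih1 h1]; exists (npair e s) => //.
  by exists e, s; rewrite npairE.
- move=> h; exists (npair (npair e (nfst n)) (nsnd n)).
    exists (npair e (nfst n)), (nsnd n); split=> //.
      exists e, (nfst n); rewrite npairE; split=> //.
      by exists n; rewrite ?npairE.
    by exists n; rewrite ?npairE.
  rewrite ?npairE; elim: (nsnd n) r h => [|k ih] r /=; first exact: ih1.
  move=> [s /ih hs /ih2 hr]; exists s => //.
  exists (npair e (npair (nfst n) (npair k s))) => //.
  exists e, (npair (nfst n) (npair k s)); split=> //.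
    by exists (npair e (nfst n)); rewrite ?npairE.
  exists (nfst n), (npair k s); split; rewrite ?npairE //.
  by exists (npair e (nfst n)); rewrite ?npairE.
(* The search variable is appended outside the pair (e, n), whereas the inner program expects it
   beside n. *)
- have arg m : run phi (Pair (Comp Fst Fst) (Pair (Comp Snd Fst) Snd))
      (npair (npair e n) m) (npair e (npair n m)).
    exists e, (npair n m); split=> //.
      by exists (npair e n); rewrite /= ?npairE.
    exists n, m; split; rewrite /= ?npairE //.
    by exists (npair e n); rewrite /= ?npairE.
  move=> [h0 hm]; split; first by exists (npair e (npair n r)); [exact: arg|exact: ih1].
  move=> m /hm [s hs]; exists s.
  by exists (npair e (npair n m)); [exact: arg|exact: ih1].
Qed.

(** Unbounded search for the least witness; [Mu] looks for a zero, hence the negated predicate. *)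
Lemma mu_search (P : nat -> nat -> bool) :
  computable2 (fun n k => P n k) -> (forall n, exists k, P n k) ->
  exists2 f, computable f & forall n, P n (f n).
Proof.
move=> /computable_not [c hc] exP.
exists (fun n => ex_minn (exP n)) => [|n]; last by case: ex_minnP.
exists (Mu c) => n /=; case: ex_minnP => k hk kmin; split.
  by have := hc (npair n k); rewrite /= ?npairE hk.
move=> m mk; exists 0; have := hc (npair n m); rewrite /= ?npairE.
by case: (boolP (P n m)) => // /kmin; rewrite leqNgt mk.
Qed.

End Computability.

Lemma computable_comp3 F f g h :
  computable3 F -> computable f -> computable g -> computable h ->
  computable (fun n => F (f n) (g n) (h n)).
Proof.
move=> hF hf hg hh.
have := computable_comp hF (computable_pair hf (computable_pair hg hh)).
by under eq_fun do rewrite !npairE.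
Qed.

Ltac computability :=
  repeat first
    [ assumption
    | exact: computable_id
    | exact: computable_const
    | exact: (computable_nfst computable_id)
    | exact: (computable_succ computable_id)
    | exact: (computable_nsnd computable_id)
    | match goal with
      | |- computable2 _ => rewrite /computable2
      | |- computable3 _ => rewrite /computable3
      | H : computable ?h |- computable (fun n => ?h (@?g n)) =>
          apply: (computable_comp H)
      | H : computable2 ?h |- computable (fun n => ?h (@?f n) (@?g n)) =>
          apply: (computable_comp2 H)
      | H : computable3 ?h
        |- computable (fun n => ?h (@?e n) (@?f n) (@?g n)) =>
          apply: (computable_comp3 H)
      | |- computable (fun n => npair _ _) => apply: computable_pair
      | |- computable (fun n => nfst _) => apply: computable_nfst
      | |- computable (fun n => nsnd _) => apply: computable_nsnd
      | |- computable (fun n => nat_of_bool (~~ _)) => apply: computable_not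
      | |- computable (fun n => nat_of_bool (_ && _)) => apply: computable_and
      | |- computable (fun n => nat_of_bool (_ <= _)%N) =>
          apply: computable_leq
      | |- computable (fun n => (_ + _)%N) => apply: computable_add
      | |- computable (fun n => (_ * _)%N) => apply: computable_mul
      | |- computable (fun n => (_ - _)%N) => apply: computable_sub
      | |- computable (fun n => (_ ^ _)%N) => apply: computable_expn
      | |- computable (fun n => (_ %/ _.+1)%N) => apply: computable_divn
      | |- computable (fun n => (_ %% _.+1)%N) => apply: computable_modn
      | |- computable (fun n => _.-1) => apply: computable_pred
      | |- computable (fun n => _.+1) => apply: computable_succ
      end ].

(** * Dyadic cells inside unions of rational intervals *)

Definition num1 (c : nat) := nfst (nfst c).
Definition num2 (c : nat) := nsnd (nfst c).
Definition den (c : nat) := (nsnd c).+1.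

(* Here [i] stands for the grid point (i - o)/2^s. *)
Definition code_lt_grid (c s o i : nat) : bool :=
  (num1 c * 2 ^ s + o * den c < i * den c + num2 c * 2 ^ s)%N.

(** Denominators are cleared and negative terms moved across, so that natural numbers suffice. *)
Definition grid_lt_code (c s o i : nat) : bool :=
  (i * den c + num2 c * 2 ^ s < num1 c * 2 ^ s + o * den c)%N.

(** The closed cell lies inside a single one of the first [T] intervals. This is decidable; cells
    covered only by several intervals jointly are left to finer levels. *)
Definition covers (A B : nat -> nat) (T s o i : nat) : bool :=
  (0 < \sum_(k < T) (code_lt_grid (A k) s o i && grid_lt_code (B k) s o i.+1))%N.

Lemma computable_covers A B T s o i :
  computable2 A -> computable2 B -> computable T -> computable s ->
  computable o -> computable i ->
  computable (fun n => covers (A n) (B n) (T n) (s n) (o n) (i n)).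
Proof.
move=> hA hB hT hs ho hi; apply: computable_leq; first exact: computable_const.
apply: (@computable_sum (fun n k => code_lt_grid (A n k) (s n) (o n) (i n) &&
  grid_lt_code (B n k) (s n) (o n) (i n).+1)) => //.
by rewrite /code_lt_grid /grid_lt_code /num1 /num2 /den; computability.
Qed.

Definition cover_count (A B : nat -> nat) (T s o n : nat) : nat :=
  (\sum_(i < n) covers A B T s o i)%N.

Lemma computable_cover_count A B T s o k :
  computable2 A -> computable2 B -> computable T -> computable s ->
  computable o -> computable k ->
  computable (fun n => cover_count (A n) (B n) (T n) (s n) (o n) (k n)).
Proof.
move=> hA hB hT hs ho hk; apply: (@computable_sum (fun n i =>
  covers (A n) (B n) (T n) (s n) (o n) i)) => //.
by apply: (@computable_covers (fun w => A (nfst w)) (fun w => B (nfst w)));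
  computability.
Qed.

Section RealValues.
Variable R : realType.
Implicit Types (A B : nat -> nat) (c s o i : nat) (x y : R).

Definition code_val c : R := ratr (rat_of_code c).

Lemma code_valE c : code_val c = ((num1 c)%:R - (num2 c)%:R) / (den c)%:R.
Proof. by rewrite /code_val /rat_of_code fmorph_div rmorphB !rmorph_nat. Qed.

Definition grid s o i : R := (i%:R - o%:R) / 2 ^+ s.

Lemma den_gt0 c : 0 < (den c)%:R :> R.
Proof. by rewrite ltr0n. Qed.

Lemma exp2_gt0 s : 0 < 2 ^+ s :> R.
Proof. by rewrite exprn_gt0. Qed.

Hint Resolve den_gt0 exp2_gt0 : core.

Lemma code_lt_gridE c s o i : code_lt_grid c s o i = (code_val c < grid s o i).
Proof.
rewrite code_valE /grid ltr_pdivrMr // mulrAC ltr_pdivlMr //.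
rewrite /code_lt_grid -(ltr_nat R) !natrD !natrM !natrX.
by apply/idP/idP; lra.
Qed.

Lemma grid_lt_codeE c s o i : grid_lt_code c s o i = (grid s o i < code_val c).
Proof.
rewrite code_valE /grid ltr_pdivlMr // mulrAC ltr_pdivrMr //.
rewrite /grid_lt_code -(ltr_nat R) !natrD !natrM !natrX.
by apply/idP/idP; lra.
Qed.

Lemma coversP A B T s o i :
  reflect (exists2 k, (k < T)%N &
             code_val (A k) < grid s o i /\ grid s o i.+1 < code_val (B k))
          (covers A B T s o i).
Proof.
rewrite /covers lt0n sum_nat_eq0 negb_forall; apply: (iffP existsP) => [[k]|[k kT]].
  rewrite /= eqb0 negbK code_lt_gridE grid_lt_codeE => /andP hk.
  by exists k => //; exact: ltn_ord.
move=> /andP hk; exists (Ordinal kT).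
by rewrite /= eqb0 negbK code_lt_gridE grid_lt_codeE.
Qed.

(** Half-open, so that the cells of one level are disjoint and leave no gaps. *)
Definition cell s o i : set R := `[grid s o i, grid s o i.+1[%classic.

Definition covered A B T s o n : set R :=
  \big[setU/set0]_(i < n | covers A B T s o i) cell s o i.

Lemma gridS s o i : grid s o i.+1 = grid s o i + 2 ^- s.
Proof. by rewrite /grid -natr1; field; rewrite lt0r_neq0. Qed.

Lemma ltr_grid s o : {mono grid s o : i j / (i < j)%N >-> i < j}.
Proof. by move=> i j; rewrite /grid ltr_pM2r ?invr_gt0 // ltrD2r ltr_nat. Qed.

Lemma cell_inj s o i j x : cell s o i x -> cell s o j x -> i = j.
Proof.
rewrite /cell /= !in_itv /= => /andP[h1 h2] /andP[h3 h4].
have := le_lt_trans h1 h4; have := le_lt_trans h3 h2.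
by rewrite !ltr_grid !ltnS => ? ?; apply/eqP; rewrite eqn_leq; apply/andP.
Qed.

Lemma coveredP A B T s o n x :
  covered A B T s o n x <-> exists2 i, (i < n)%N & covers A B T s o i /\ cell s o i x.
Proof.
rewrite /covered -(big_mkord (covers A B T s o) (cell s o)) -bigcup_seq_cond; split.
  by move=> [i /=]; rewrite mem_index_iota /= => /andP[ni ci] xi; exists i.
by move=> [i ni [ci xi]]; exists i => //=; rewrite mem_index_iota /= ni.
Qed.

Lemma covered_sub A B T s o n :
  covered A B T s o n `<=` \bigcup_(k < T) `]code_val (A k), code_val (B k)[%classic.
Proof.
move=> x /coveredP [i _ [/coversP[k kT [h1 h2]]]].
rewrite /cell /= in_itv /= => /andP[h3 h4]; exists k => //=.
by rewrite in_itv /= (lt_le_trans h1 h3) (lt_trans h4 h2).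
Qed.

(** The interval around a cell also surrounds each subcell. Level, offset and number of intervals
    may change at once. *)
Lemma covers_sub A B T T' s o i s' o' i' :
  (T <= T')%N -> grid s o i <= grid s' o' i' ->
  grid s' o' i'.+1 <= grid s o i.+1 -> covers A B T s o i -> covers A B T' s' o' i'.
Proof.
move=> TT h1 h2 /coversP[k kT [h3 h4]]; apply/coversP.
by exists k; [exact: leq_trans TT|split; lra].
Qed.

Lemma cell_exists s o n x :
  grid s o 0 <= x < grid s o n -> exists2 i, (i < n)%N & cell s o i x.
Proof.
elim: n => [|n ih] /andP[h1 h2]; first by lra.
have [xn|nx] := ltP x (grid s o n).
  by have [|i ni hi] := ih; [rewrite h1|exists i => //; exact: leqW].
by exists n => //; rewrite /cell /= in_itv /= nx.
Qed.

(** * Lebesgue measure of unions of cells and intervals *)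

Local Notation mu := (@lebesgue_measure R).

Lemma le_lebesgue (X Y : set R) :
  measurable X -> measurable Y -> X `<=` Y -> (mu X <= mu Y)%E.
Proof. by move=> mX mY XY; apply: le_measure; rewrite ?inE. Qed.

Lemma lebesgue_setU_le (X Y : set R) :
  measurable X -> measurable Y -> (mu (X `|` Y) <= mu X + mu Y)%E.
Proof. by move=> mX mY; exact: (measureU2 lebesgue_measure). Qed.

Lemma lebesgue_bigsetU_le (F : nat -> set R) n : (forall i, measurable (F i)) ->
  (mu (\big[setU/set0]_(i < n) F i) <= \sum_(i < n) mu (F i))%E.
Proof. by move=> mF; apply: (Boole_inequality lebesgue_measure) => i _; exact: mF. Qed.

Lemma measurable_covered A B T s o n : measurable (covered A B T s o n).
Proof. by apply: bigsetU_measurable => i _; exact: measurable_itv. Qed.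

Lemma lebesgue_itv_le (b1 b2 : bool) x y :
  x <= y -> (mu [set` Interval (BSide b1 x) (BSide b2 y)] = (y - x)%:E)%E.
Proof.
move=> xy; rewrite lebesgue_measure_itv /= lte_fin.
by case: ltgtP xy => // -> _; rewrite subrr.
Qed.

(** The cells are disjoint and of equal length, so the measure is a computable count. *)
Lemma lebesgue_covered A B T s o n :
  mu (covered A B T s o n) = ((cover_count A B T s o n)%:R / 2 ^+ s)%:E.
Proof.
rewrite /covered /cover_count measure_bigsetU_ord; first last.
- by apply/trivIsetP => i j _ _; apply: contraNeq =>
    /set0P[x [/cell_inj h /h /ord_inj/eqP]].
- by move=> i; exact: measurable_itv.
rewrite natr_sum mulr_suml -sumEFin big_mkcond /=; apply: eq_bigr => i _.
case: ifP => _; last by rewrite mul0r.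
rewrite /cell lebesgue_itv_le gridS; last by rewrite lerDl invr_ge0 ltW.
by rewrite addrAC subrr add0r mul1r.
Qed.

Lemma lebesgue_bigcup_le (F : nat -> set R) (d : nat -> R) (e : R) :
  (forall k, measurable (F k)) -> (forall k, (mu (F k) <= (d k)%:E)%E) ->
  (forall N, \sum_(k < N) d k <= e) -> (mu (\bigcup_k F k) <= e%:E)%E.
Proof.
move=> mF muF de; apply: le_trans.
  apply: measure_sigma_subadditive (@subset_refl _ _) => //.
  by apply: bigcup_measurable => k _; exact: mF.
apply: lime_le; first by apply: is_cvg_nneseries => ? _ _.
apply: nearW => N; rewrite big_mkord; apply: le_trans.
  by apply: lee_sum => k _; exact: muF.
by rewrite sumEFin lee_fin.
Qed.

(* What the counted cells miss lies within 2^-M of the 2 * T ends. *)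
Lemma lebesgue_cover_count A B T M :
  (forall k, 0 <= code_val (A k)) -> (forall k, code_val (B k) <= 1) ->
  let S := \bigcup_(k < T) `]code_val (A k), code_val (B k)[%classic in
  ((((cover_count A B T M 0 (2 ^ M))%:R / 2 ^+ M)%:E <= mu S) /\
   (mu S <= ((cover_count A B T M 0 (2 ^ M))%:R / 2 ^+ M + 2 * T%:R / 2 ^+ M)%:E))%E.
Proof.
move=> A0 B1 S.
have mS : measurable S by apply: bigcup_measurable => k _; exact: measurable_itv.
split.
  rewrite -lebesgue_covered; apply: le_lebesgue => //; first
    exact: measurable_covered.
  exact: covered_sub.
pose F k := `]code_val (A k), code_val (A k) + 2 ^- M]%classic `|`
  `[code_val (B k) - 2 ^- M, code_val (B k)[%classic.
have mF k : measurable (F k) by apply: measurableU; exact: measurable_itv.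
have mFs : measurable (\big[setU/set0]_(k < T) F k) by exact: bigsetU_measurable.
have e0 : 0 <= 2 ^- M :> R by rewrite invr_ge0 ltW.
have SF : S `<=` covered A B T M 0 (2 ^ M) `|` \big[setU/set0]_(k < T) F k.
  move=> x [k /= kT]; rewrite in_itv /= => /andP[ax xb].
  (* [A0] and [B1] place x in [0, 1), where the cells with offset 0 suffice. *)
  have [|i iM] := @cell_exists M 0 (2 ^ M) x.
    rewrite /grid !subr0 mul0r natrX divff ?lt0r_neq0 //.
    by have := A0 k; have := B1 k; lra.
  move=> xi; have := xi; rewrite /cell /= in_itv /= => /andP[h1 h2].
  have h3 := gridS M 0 i.
  have [h4|h4] := ltP (code_val (A k)) (grid M 0 i); last first.
    right; rewrite -bigcup_mkord; exists k => //; left => /=; rewrite in_itv /=; lra.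
  have [h5|h5] := ltP (grid M 0 i.+1) (code_val (B k)); last first.
    right; rewrite -bigcup_mkord; exists k => //; right => /=; rewrite in_itv /=; lra.
  by left; apply/coveredP; exists i => //; split=> //; apply/coversP; exists k.
have mC := measurable_covered A B T M 0 (2 ^ M).
apply: le_trans; first by apply: le_lebesgue SF => //; exact: measurableU.
apply: le_trans; first exact: lebesgue_setU_le.
rewrite EFinD; apply: leeD; first by rewrite -lebesgue_covered.
apply: le_trans; first exact: lebesgue_bigsetU_le.
have FM k : (mu (F k) <= (2 / 2 ^+ M)%:E)%E.
  apply: le_trans; first by apply: lebesgue_setU_le; exact: measurable_itv.
  rewrite !lebesgue_itv_le; [|lra|lra].
  by rewrite -EFinD lee_fin; lra.
apply: le_trans; first by apply: lee_sum => k _; exact: FM.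
by rewrite sumEFin lee_fin sumr_const card_ord -[_ *+ T]mulr_natr mulrAC.
Qed.

End RealValues.

(** * Decomposition into maximal dyadic cells *)

Section DyadicDecomposition.
Variables A B : nat -> nat.

(** The number s is both the resolution and the number of intervals inspected, so that one parameter
    exhausts the union inside [0, 1]. *)
Definition level (s j : nat) : bool := covers A B s s 0 j.

(** The maximal accepted cells: the parent [j %/ 2] is not yet accepted. Level 0 inspects no
    interval and accepts nothing, so [s.-1] is harmless there. *)
Definition new_cell (s j : nat) : bool :=
  [&& (j < 2 ^ s)%N, level s j & ~~ level s.-1 (j %/ 2)].

Definition level_count (s : nat) : nat := cover_count A B s s 0 (2 ^ s).

(* The offset s * 2 ^ s makes the window [-s, s]. *)
Definition window_count (s : nat) : nat :=
  cover_count A B s s (s * 2 ^ s) (2 * s * 2 ^ s).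

Lemma covers0 s o i : covers A B 0 s o i = false.
Proof. by rewrite /covers big_ord0. Qed.

Lemma sum_ord_double (F : nat -> nat) n :
  (\sum_(i < 2 * n) F i = \sum_(i < n) (F (2 * i) + F (2 * i).+1))%N.
Proof.
elim: n => [|n ih]; first by rewrite muln0 !big_ord0.
by rewrite mulnS add2n !big_ord_recr /= ih addnA.
Qed.

Variable R : realType.
Local Notation mu := (@lebesgue_measure R).
Local Notation grid := (@grid R).

Definition intervals : set R :=
  \bigcup_k `]code_val R (A k), code_val R (B k)[%classic.

Lemma grid_double s i : grid s.+1 0 (2 * i) = grid s 0 i.
Proof.
rewrite /grid !subr0 natrM exprS; field.
by rewrite lt0r_neq0 // exprn_gt0.
Qed.

Lemma grid_double_le s i :
  [/\ grid s 0 i <= grid s.+1 0 (2 * i), grid s.+1 0 (2 * i).+1 <= grid s 0 i.+1,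
      grid s 0 i <= grid s.+1 0 (2 * i).+1 & grid s.+1 0 (2 * i).+2 <= grid s 0 i.+1].
Proof.
have h := grid_double s i; have := grid_double s i.+1; rewrite mulnS add2n => h'.
have e1 := gridS R s.+1 0 (2 * i); have e2 := gridS R s.+1 0 (2 * i).+1.
have : 0 < 2 ^- s.+1 :> R by rewrite invr_gt0 exprn_gt0.
by split; lra.
Qed.

Lemma level_double s i : level s i -> level s.+1 (2 * i) && level s.+1 (2 * i).+1.
Proof.
have [h1 h2 h3 h4] := grid_double_le s i.
by move=> h; apply/andP; split; apply: (covers_sub (R := R)) h.
Qed.

(** Both children of an accepted cell are accepted but not new; the accepted children of any other
    cell are new. *)
Lemma new_cell_count s :
  (\sum_(j < 2 ^ s.+1) new_cell s.+1 j + 2 * level_count s = level_count s.+1)%N.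
Proof.
rewrite /level_count /cover_count expnS
  (sum_ord_double (fun j => nat_of_bool (new_cell s.+1 j)))
  (sum_ord_double (fun j => nat_of_bool (level s.+1 j))) big_distrr -big_split /=.
apply: eq_bigr => i _; rewrite /new_cell -/(level s i) -/(level s.+1 _) -/(level s.+1 _).
have i2 : (2 * i.+1 <= 2 ^ s.+1)%N by rewrite expnS leq_mul2l ltn_ord.
have -> : (2 * i < 2 ^ s.+1)%N by lia.
have -> : ((2 * i).+1 < 2 ^ s.+1)%N by lia.
have -> : (2 * i %/ 2 = i)%N by lia.
have -> : ((2 * i).+1 %/ 2 = i)%N by lia.
case: (boolP (level s i)) => [/level_double /andP[-> ->] //|_] /=.
by rewrite !andbT addn0.
Qed.

Definition new_size (s : nat) : R := (\sum_(j < 2 ^ s) new_cell s j)%:R / 2 ^+ s.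
Definition level_size (s : nat) : R := (level_count s)%:R / 2 ^+ s.
Definition window_size (s : nat) : R := (window_count s)%:R / 2 ^+ s.

Lemma level_size0 : level_size 0 = 0.
Proof.
by rewrite /level_size /level_count /cover_count big1 ?mul0r // => i _; rewrite covers0.
Qed.

(** Telescoping: the new cells of a level account for the increase of the accepted length. *)
Lemma sum_new_size K N :
  \sum_(i < N) new_size (K + i).+1 = level_size (K + N) - level_size K.
Proof.
elim: N => [|N ih]; first by rewrite big_ord0 addn0 subrr.
rewrite big_ord_recr /= ih addnS.
suff -> : level_size (K + N).+1 = level_size (K + N) + new_size (K + N).+1 by lra.
rewrite /level_size /new_size -new_cell_count exprS natrD natrM; field.
by rewrite lt0r_neq0 // exprn_gt0.
Qed.

Let C s : set R := covered A B s s 0 (2 ^ s).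
Let V s : set R := covered A B s s (s * 2 ^ s) (2 * s * 2 ^ s).

Lemma measurable_intervals : measurable intervals.
Proof. by apply: bigcup_measurable => k _; exact: measurable_itv. Qed.

(** The test sets may leave [0, 1], while [w] bounds the measure on the whole line. The part of
    [V K] outside [0, 1) is disjoint from [C N], so together they measure at most [w]; and [V K] is
    covered by that part and [C K]. Subtracting eliminates the outer part. *)
Lemma level_size_window (w : R) K N : (mu intervals <= w%:E)%E ->
  level_size N - level_size K <= w - window_size K.
Proof.
move=> muw; pose I01 : set R := `[0, 1[%classic.
have mI : measurable I01 by exact: measurable_itv.
have mC s : measurable (C s) by exact: measurable_covered.
have mV s : measurable (V s) by exact: measurable_covered.
have mD : measurable (V K `\` I01) by exact: measurableD.
(* Cells of [0, 1] reappear in the window with a shifted index. *)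
have grid0 s i : grid s 0 i = grid s (s * 2 ^ s) (i + s * 2 ^ s).
  by rewrite /grid natrD addrK subr0.
have VC : V K `<=` (V K `\` I01) `|` C K.
  move=> x Vx; have [xI|xI] := pselect (I01 x); last by left.
  right; move: xI; rewrite /I01 /= in_itv /= => x01.
  have [|j jK xj] := @cell_exists R K 0 (2 ^ K) x.
    by rewrite /grid !subr0 mul0r natrX divff // lt0r_neq0 // exprn_gt0.
  have /coveredP[i iK [ci xi]] := Vx.
  apply/coveredP; exists j => //; split=> //.
  have ij : i = (j + K * 2 ^ K)%N.
    by apply: cell_inj xi _; move: xj; rewrite /cell !grid0 addSn.
  by apply: (covers_sub (R := R)) ci; rewrite ?grid0 ?ij ?addSn.
have disj : C N `&` (V K `\` I01) = set0.
  apply/seteqP; split=> // x [/coveredP [i iN [_]]].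
  rewrite /cell /= in_itv /= => /andP[h1 h2].
  move=> [_]; apply; rewrite /I01 /= in_itv /=; apply/andP; split.
    by apply: le_trans h1; rewrite /grid subr0 divr_ge0.
  apply: lt_le_trans h2 _; rewrite /grid subr0 ler_pdivrMr ?exprn_gt0 // mul1r.
  by rewrite -natrX ler_nat.
have VW s : V s `<=` intervals.
  by move=> x /covered_sub [k _ xk]; exists k.
have CW s : C s `<=` intervals.
  by move=> x /covered_sub [k _ xk]; exists k.
have h1 : (mu (V K) <= mu (V K `\` I01) + mu (C K))%E.
  apply: le_trans (lebesgue_setU_le mD (mC K)).
  by apply: le_lebesgue VC => //; exact: measurableU.
have h2 : (mu (C N) + mu (V K `\` I01) <= w%:E)%E.
  rewrite -(measureU lebesgue_measure (mC N) mD disj); apply: le_trans muw.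
  apply: le_lebesgue; [exact: measurableU|exact: measurable_intervals|].
  by move=> x [/CW//|[/VW]].
move: h1 h2; rewrite !lebesgue_covered.
(* Infinite values contradict [h1] or [h2]; a finite z cancels. *)
case: (mu (V K `\` I01)) => [z| |] //.
rewrite -!EFinD !lee_fin /level_size /window_size /level_count /window_count => h1 h2.
lra.
Qed.

Lemma exp2_lt (e : R) : 0 < e ->
  exists K0, forall K, (K0 <= K)%N -> 2 ^- K < e.
Proof.
move=> e0; exists (Num.bound e^-1) => K hK.
rewrite invf_plt ?posrE ?exprn_gt0 //.
apply: lt_le_trans (archi_boundP _) _; first by rewrite invr_ge0 ltW.
by rewrite -natrX ler_nat (leq_trans hK) // ltnW // ltn_expl.
Qed.

Lemma lt_cell_left s o i (x y : R) : cell s o i x ->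
  2 ^- s < x - y -> y < grid s o i.
Proof. by rewrite /cell /= in_itv /= => /andP[_]; rewrite gridS; lra. Qed.

Lemma cell_right_lt s o i (x y : R) : cell s o i x ->
  2 ^- s < y - x -> grid s o i.+1 < y.
Proof. by rewrite /cell /= in_itv /= => /andP[+ _]; rewrite gridS; lra. Qed.

Lemma window_bigcup : \bigcup_s V s = intervals.
Proof.
apply/seteqP; split=> [x [s _ /covered_sub [k _ xk]]|x [k _]]; first by exists k.
rewrite /= in_itv /= => /andP[ax xb].
have [K1 hK1] := exp2_lt (e := x - code_val R (A k)) ltac:(lra).
have [K2 hK2] := exp2_lt (e := code_val R (B k) - x) ltac:(lra).
(* This level inspects interval k, has cells shorter than the distances from x to both ends, and has
   x in its window. *)
pose K := (k.+1 + K1 + K2 + Num.bound `|x|)%N; exists K => //.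
have xK : `|x| < K%:R.
  by apply: lt_le_trans (archi_boundP _) _ => //; rewrite ler_nat leq_addl.
have gridK i : grid K (K * 2 ^ K) i = i%:R / 2 ^+ K - K%:R.
  by rewrite /grid natrM natrX; field; rewrite lt0r_neq0 // exprn_gt0.
have [|i iK xi] := @cell_exists R K (K * 2 ^ K) (2 * K * 2 ^ K) x.
  rewrite !gridK mul0r 2!natrM natrX mulfK ?lt0r_neq0 ?exprn_gt0 //.
  by move: xK; rewrite ltr_norml => /andP[]; lra.
apply/coveredP; exists i => //; split=> //; apply/(coversP R).
exists k; first by rewrite /K; lia.
split; first by apply: lt_cell_left xi (hK1 _ _); rewrite /K; lia.
by apply: cell_right_lt xi (hK2 _ _); rewrite /K; lia.
Qed.

Lemma window_nondecreasing s : V s `<=` V s.+1.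
Proof.
move=> x /coveredP[i iK [ci]]; rewrite /cell /= in_itv /= => /andP[h1 h2].
(* Halving the cells doubles the index; moving the left end of the window by 1 adds [2 ^ s.+1]. *)
have grid2 j : grid s.+1 (s.+1 * 2 ^ s.+1) (2 * j + 2 ^ s.+1) = grid s (s * 2 ^ s) j.
  rewrite /grid !natrD !natrM !natrX exprS -natr1; field.
  by rewrite lt0r_neq0 // exprn_gt0.
have e1 := grid2 i; have e2 := grid2 i.+1.
have e3 := gridS R s.+1 (s.+1 * 2 ^ s.+1) (2 * i + 2 ^ s.+1).
have e4 := gridS R s.+1 (s.+1 * 2 ^ s.+1) (2 * i + 2 ^ s.+1).+1.
have e0 : 0 < 2 ^- s.+1 :> R by rewrite invr_gt0 exprn_gt0.
rewrite mulnS add2n !addSn in e2.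
have e5 : (2 ^ s.+1 = 2 * 2 ^ s)%N by rewrite expnS.
have i2 : ((2 * i + 2 ^ s.+1).+1 < 2 * s.+1 * 2 ^ s.+1)%N by nia.
apply/coveredP.
have [xm|mx] := ltP x (grid s.+1 (s.+1 * 2 ^ s.+1) (2 * i + 2 ^ s.+1).+1).
  exists (2 * i + 2 ^ s.+1)%N; first exact: ltnW.
  split; first by apply: (covers_sub (R := R)) ci => //; lra.
  by rewrite /cell /= in_itv /=; apply/andP; split=> //; lra.
exists (2 * i + 2 ^ s.+1).+1; first exact: i2.
split; first by apply: (covers_sub (R := R)) ci => //; lra.
by rewrite /cell /= in_itv /=; apply/andP; split=> //; lra.
Qed.

(** Continuity of the measure from below along the windows. It makes the search for an exhausting
    level terminate. *)
Lemma window_size_cvg (w e : R) : (mu intervals <= w%:E)%E -> 0 < e ->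
  exists K, (mu intervals <= (window_size K + e)%:E)%E.
Proof.
move=> muw e0.
have /fineK muE : mu intervals \is a fin_num.
  by rewrite ge0_fin_numE ?measure_ge0 // (le_lt_trans muw) ?ltry.
have mV s : measurable (V s) by exact: measurable_covered.
have : (lebesgue_measure \o V) s @[s --> \oo] --> mu (\bigcup_s V s).
  apply: nondecreasing_cvg_mu => //.
    by rewrite window_bigcup; exact: measurable_intervals.
  by apply/nondecreasing_seqP => s; apply/subsetPset; exact: window_nondecreasing.
rewrite window_bigcup -muE => /fine_cvgP[_ /cvgrPdist_lt /(_ _ e0)].
move=> [K _ /(_ K (leqnn K))] /=; rewrite lebesgue_covered /= => h.
exists K; rewrite lee_fin; move: h.
by rewrite ltr_norml /window_size /window_count => /andP[]; lra.
Qed.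

(** Closed cells are needed for x = 1, which belongs to the last one. *)
Lemma closed_cell_exists s x : 0 <= x <= 1 ->
  exists2 j, (j < 2 ^ s)%N & grid s 0 j <= x <= grid s 0 j.+1.
Proof.
move=> /andP[x0]; rewrite le_eqVlt => /orP[/eqP ->|x1].
  exists (2 ^ s).-1; first by rewrite ltn_predL expn_gt0.
  rewrite /grid !subr0 prednK ?expn_gt0 // ler_pdivrMr ?exprn_gt0 //.
  rewrite ler_pdivlMr ?exprn_gt0 // !mul1r natrX lexx andbT -natrX ler_nat.
  exact: leq_pred.
have [|j js] := @cell_exists R s 0 (2 ^ s) x.
  by rewrite /grid !subr0 mul0r natrX divff ?x0 // lt0r_neq0 // exprn_gt0.
by rewrite /cell /= in_itv /= => /andP[h1 h2]; exists j => //; rewrite h1 ltW.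
Qed.

(** A sufficiently fine cell about x is accepted. At the least level with an accepted closed cell
    containing x, the parent contains x too and so cannot be accepted. *)
Lemma new_cell_exists x : 0 <= x <= 1 -> intervals x ->
  exists s j, new_cell s j /\ grid s 0 j <= x <= grid s 0 j.+1.
Proof.
move=> x01 [k _]; rewrite /= in_itv /= => /andP[ax xb].
pose Q s := exists j, [/\ (j < 2 ^ s)%N, level s j & grid s 0 j <= x <= grid s 0 j.+1].
have exQ : exists s, `[< Q s >].
  have [K1 hK1] := exp2_lt (e := x - code_val R (A k)) ltac:(lra).
  have [K2 hK2] := exp2_lt (e := code_val R (B k) - x) ltac:(lra).
  pose K := (k.+1 + K1 + K2)%N; exists K; apply/asboolP.
  have [j jK xj] := closed_cell_exists K x01.
  exists j; split=> //; apply/(coversP R); exists k; first by rewrite /K; lia.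
  move: xj; rewrite gridS => /andP[h1 h2].
  have := hK1 K ltac:(rewrite /K; lia); have := hK2 K ltac:(rewrite /K; lia).
  by split; lra.
case: (ex_minnP exQ) => s /asboolP [j [js lj xj]] smin; exists s, j; split=> //.
rewrite /new_cell js lj /=; case: s js lj xj smin => [|s] js lj xj smin.
  by move: lj; rewrite /level covers0.
apply/negP => /= lj2; suff : Q s by move=> /asboolP /smin; rewrite ltnn.
exists (j %/ 2)%N; split=> //; first by move: js; rewrite expnS; lia.
have [h1 h2 h3 h4] := grid_double_le s (j %/ 2).
have [je|jo] : j = (2 * (j %/ 2))%N \/ j = (2 * (j %/ 2)).+1 by clear -j; lia.
  by move: xj; rewrite [in X in X -> _]je => /andP[? ?]; apply/andP; split; lra.
by move: xj; rewrite [in X in X -> _]jo => /andP[? ?]; apply/andP; split; lra.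
Qed.

(** For K = 0 both sizes in [level_size_window] vanish, so [w] bounds the length of all accepted
    cells of [0, 1], hence of each one. *)
Lemma level_lebesgue (w : R) s j : (mu intervals <= w%:E)%E ->
  (j < 2 ^ s)%N -> level s j -> 2 ^- s <= w.
Proof.
move=> muw js lj; have := level_size_window 0 s muw.
rewrite level_size0 /window_size /window_count muln0 mul0n /cover_count big_ord0 mul0r.
rewrite !subr0; apply: le_trans; rewrite /level_size -[leLHS]mul1r ler_pM2r.
  rewrite ler1n /level_count /cover_count (bigD1 (Ordinal js)) //= -/(level s j) lj.
  by rewrite addn_gt0.
by rewrite invr_gt0 exprn_gt0.
Qed.

End DyadicDecomposition.

(** * Rational intervals modulo 1 *)

(* The centre v is reduced modulo 1 and shifted by z - 1; the interval of
   radius rho / (den v * 2 ^ s) about it is cut down to [0, 1] by truncated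
   subtraction. *)
Definition centre_num (v s z : nat) : nat :=
  (((num1 v + num2 v * nsnd v) %% den v) * 2 ^ s + z * (den v * 2 ^ s))%N.

Definition lower_code (v s rho z : nat) : nat :=
  npair (npair (centre_num v s z - (den v * 2 ^ s + rho)) 0) (den v * 2 ^ s).-1.

Definition upper_code (v s rho z : nat) : nat :=
  npair (npair (minn (den v * 2 ^ s) (centre_num v s z + rho - den v * 2 ^ s)) 0)
        (den v * 2 ^ s).-1.

Lemma computable_lower_code v s rho z :
  computable v -> computable s -> computable rho -> computable z ->
  computable (fun n => lower_code (v n) (s n) (rho n) (z n)).
Proof.
by rewrite /lower_code /centre_num /den /num1 /num2 => *; computability.
Qed.

Lemma computable_upper_code v s rho z :
  computable v -> computable s -> computable rho -> computable z ->
  computable (fun n => upper_code (v n) (s n) (rho n) (z n)).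
Proof.
rewrite /upper_code /centre_num /den /num1 /num2 => *.
by under eq_fun do rewrite minnE; computability.
Qed.

Section UnitIntervals.
Variables (R : realType) (v s rho z : nat).

Local Notation code_val := (@code_val R).

Let D := (den v * 2 ^ s)%N.
Let c : R := ((num1 v + num2 v * nsnd v) %% den v)%:R / (den v)%:R.
Let r : R := rho%:R / D%:R.
Let centre : R := c + z%:R - 1.

Let D_gt0 : (0 < D)%N. Proof. by rewrite muln_gt0 expn_gt0. Qed.
Let DR_gt0 : 0 < D%:R :> R. Proof. by rewrite ltr0n. Qed.

Lemma code_val_pair N : code_val (npair (npair N 0) D.-1) = N%:R / D%:R.
Proof. by rewrite code_valE /num1 /num2 /den !npairE subr0 prednK. Qed.

Lemma centre_numE : (centre_num v s z)%:R = (centre + 1) * D%:R :> R.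
Proof.
rewrite /centre_num -/D natrD natrM (natrM _ z) /centre /c /D natrM natrX; field.
by rewrite lt0r_neq0 // ltr0n.
Qed.

Lemma lower_code_ge0 : 0 <= code_val (lower_code v s rho z).
Proof. by rewrite /lower_code code_val_pair divr_ge0. Qed.

Lemma upper_code_le1 : code_val (upper_code v s rho z) <= 1.
Proof.
by rewrite /upper_code code_val_pair ler_pdivrMr // mul1r ler_nat geq_minl.
Qed.

Lemma lower_code_ge : centre - r <= code_val (lower_code v s rho z).
Proof.
rewrite /lower_code code_val_pair ler_pdivlMr // mulrBl /r divfK ?lt0r_neq0 //.
have -> : centre * D%:R = (centre_num v s z)%:R - D%:R by rewrite centre_numE; ring.
rewrite -/D; set m := centre_num _ _ _.
rewrite lerBlDr lerBlDr -!natrD ler_nat; lia.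
Qed.

Lemma lower_code_lt y : 0 < y -> centre - r < y -> code_val (lower_code v s rho z) < y.
Proof.
move=> y0; rewrite /lower_code code_val_pair ltr_pdivrMr //.
rewrite -(ltr_pM2r DR_gt0) mulrBl [r * _]divfK ?lt0r_neq0 //.
have -> : centre * D%:R = (centre_num v s z)%:R - D%:R by rewrite centre_numE; ring.
rewrite -/D; set m := centre_num _ _ _ => h.
case: (leqP (D + rho) m) => [hm|/ltnW]; first by rewrite natrB // natrD; lra.
by rewrite -subn_eq0 => /eqP ->; rewrite mulr_gt0.
Qed.

(** In a nonempty interval the upper end is positive, so the truncated subtraction was exact. *)
Lemma upper_code_le :
  code_val (lower_code v s rho z) < code_val (upper_code v s rho z) ->
  code_val (upper_code v s rho z) <= centre + r.
Proof.
move=> h; have := le_lt_trans lower_code_ge0 h.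
rewrite /upper_code code_val_pair ltr_pdivlMr // mul0r ltr0n leq_min => /andP[_ h2].
rewrite ler_pdivrMr // mulrDl /r divfK ?lt0r_neq0 //.
have -> : centre * D%:R = (centre_num v s z)%:R - D%:R by rewrite centre_numE; ring.
move: h2; rewrite -/D; set m := centre_num _ _ _ => h2.
rewrite addrAC -natrD -natrB; last lia.
by rewrite ler_nat geq_minr.
Qed.

Lemma upper_code_gt y : y < 1 -> y < centre + r -> y < code_val (upper_code v s rho z).
Proof.
move=> y1; rewrite /upper_code code_val_pair ltr_pdivlMr //.
rewrite -(ltr_pM2r DR_gt0) mulrDl [r * _]divfK ?lt0r_neq0 //.
have -> : centre * D%:R = (centre_num v s z)%:R - D%:R by rewrite centre_numE; ring.
rewrite -/D; set m := centre_num _ _ _ => h.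
rewrite /minn; case: ifP => _; first by rewrite gtr_pMl.
case: (leqP D (m + rho)) => [hm|hm]; first by rewrite natrB // natrD; lra.
have : (m + rho)%:R < D%:R :> R by rewrite ltr_nat.
rewrite (_ : (m + rho - D)%N = 0%N); last lia.
by rewrite natrD; lra.
Qed.

(** The centre is then at least 2 and the radius at most 1. Only the translates by -1, 0 and 1 can
    meet (0, 1). *)
Lemma lower_code_ge1 :
  (3 <= z)%N -> (rho <= D)%N -> 1 <= code_val (lower_code v s rho z).
Proof.
move=> z3 rD; rewrite /lower_code code_val_pair ler_pdivlMr // mul1r ler_nat.
rewrite /centre_num -/D; nia.
Qed.

Lemma lebesgue_code_interval :
  (lebesgue_measure
     `]code_val (lower_code v s rho z), code_val (upper_code v s rho z)[%classic
    <= (2 * r)%:E)%E.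
Proof.
rewrite lebesgue_measure_itv /= lte_fin.
have r0 : 0 <= r by rewrite divr_ge0.
case: ifP => [h|_]; last by rewrite lee_fin; lra.
by have h1 := lower_code_ge; have h2 := upper_code_le h; rewrite -EFinB lee_fin; lra.
Qed.

End UnitIntervals.

(** As [den v] is [(nsnd v).+1], adding [num2 v * nsnd v] amounts to subtracting [num2 v] modulo
    [den v]. *)
Lemma code_val_modn (R : realType) (v : nat) : exists k : int,
  code_val R v = ((num1 v + num2 v * nsnd v) %% den v)%:R / (den v)%:R + k%:~R.
Proof.
set m := (num1 v + num2 v * nsnd v)%N.
exists ((m %/ den v)%:Z - (num2 v)%:Z).
have : m%:R = (m %/ den v)%:R * (den v)%:R + (m %% den v)%:R :> R.
  by rewrite -natrM -natrD -divn_eq.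
rewrite rmorphB /= code_valE -!pmulrn => h.
have -> : (m %% den v)%:R = m%:R - (m %/ den v)%:R * (den v)%:R :> R by rewrite h; ring.
rewrite /m natrD natrM /den -natr1; field.
by rewrite natr1 lt0r_neq0 // ltr0n.
Qed.

(** With k the integer split off from the value, the translate is z - 1 = k - floor y. That z is a
    natural number follows from c < 1, r <= 1 and the positive fractional part. *)
Lemma frac_part_near (R : realType) (v : nat) (r y : R) :
  `|y - code_val R v| < r -> r <= 1 -> 0 < frac_part y ->
  exists z : nat, `|frac_part y -
    (((num1 v + num2 v * nsnd v) %% den v)%:R / (den v)%:R + z%:R - 1)| < r.
Proof.
have [k ->] := code_val_modn R v; set c := _ / _ => hr r1 y0.
have c1 : c < 1.
  by rewrite /c ltr_pdivrMr ?ltr0n // mul1r ltr_nat ltn_mod.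
have k0 : (0 <= k - Num.floor y + 1)%R.
  rewrite -ltzD1 -(ltr_int R) !intrD mulrNz.
  move: hr y0; rewrite /frac_part ltr_norml => /andP[]; lra.
exists `|(k - Num.floor y + 1)%R|%N; rewrite natr_absz (ger0_norm k0).
apply: le_lt_trans hr; rewrite le_eqVlt; apply/orP; left; apply/eqP.

by rewrite !intrD mulrNz /frac_part; congr `|_|; ring.
Qed.

(** * The cover of the images *)

Section ImageCover.
Variables (R : realType) (L : nat -> nat) (V : nat -> nat -> nat -> nat).
Variables (A B : nat -> nat -> nat).
Hypotheses (cL : computable L) (cV : computable3 V).
Hypotheses (cA : computable2 A) (cB : computable2 B).

Local Notation mu := (@lebesgue_measure R).

Let W n : set R := @intervals (A n) (B n) R.

Hypothesis muW : forall n, (mu (W n) <= (2 ^- (n + L n + 7))%:E)%E.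

Let isnew n s j := new_cell (A n) (B n) s j.
(** The Lipschitz variation over a cell and the error of [V] add up to at most twice
    [2 ^ L n / 2 ^ s]; the factor 3 makes the estimate strict. Cells that are not new get radius
    0. *)
Let rho n s j := (isnew n s j * (3 * 2 ^ L n * den (V n s j)))%N.
Let lower n s j z := lower_code (V n s j) s (rho n s j) z.
Let upper n s j z := upper_code (V n s j) s (rho n s j) z.
Let I n s j z : set R :=
  `]code_val R (lower n s j z), code_val R (upper n s j z)[%classic.
Let radius n s : R := 3 * 2 ^+ L n / 2 ^+ s.

Let rhoE n s j :
  (rho n s j)%:R / (den (V n s j) * 2 ^ s)%:R = (isnew n s j)%:R * radius n s.
Proof.
rewrite /rho /radius !natrM !natrX; field.
by rewrite lt0r_neq0 ?exprn_gt0 // lt0r_neq0 // ltr0n.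
Qed.

Let radius_le1 n s j : isnew n s j -> radius n s <= 1.
Proof.
move=> /and3P[js lj _]; have := level_lebesgue (muW n) js lj.
rewrite -addnA exprD invfM => h; rewrite /radius.
have Ln0 : 0 < 2 ^+ L n :> R by rewrite exprn_gt0.
apply: (@le_trans _ _ (3 * 2 ^+ L n * 2 ^- (L n + 7))).
  rewrite ler_pM2l ?mulr_gt0 //; apply: le_trans h _.
  by rewrite ger_pMl ?invr_gt0 ?exprn_gt0 // invf_le1 ?exprn_gt0 // exprn_ege1 // ler1n.
by rewrite exprD invfM -mulrA mulVKf ?lt0r_neq0 //; lra.
Qed.

Definition cover_lower (w : nat) : nat :=
  lower (nfst (nfst w)) (nsnd (nfst w)) (nfst (nsnd w)) (nsnd (nsnd w)).
Definition cover_upper (w : nat) : nat :=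
  upper (nfst (nfst w)) (nsnd (nfst w)) (nfst (nsnd w)) (nsnd (nsnd w)).

Let computable_rho :
  computable (fun w => rho (nfst (nfst w)) (nsnd (nfst w)) (nfst (nsnd w))).
Proof.
have hlev s j : computable s -> computable j ->
    computable (fun w => level (A (nfst (nfst w))) (B (nfst (nfst w))) (s w) (j w)).
  move=> hs hj; apply: (@computable_covers (fun w => A (nfst (nfst w)))
    (fun w => B (nfst (nfst w)))) => //; computability.
rewrite /rho /isnew /new_cell /den; computability; apply: hlev; computability.
Qed.

Lemma computable_cover_lower : computable cover_lower.
Proof. by apply: computable_lower_code => //; computability. Qed.

Lemma computable_cover_upper : computable cover_upper.
Proof. by apply: computable_upper_code => //; computability. Qed.

Definition image_cover : set R := @intervals cover_lower cover_upper R.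

Let image_coverE : image_cover = [set y | exists n s j z, I n s j z y].
Proof.
apply/seteqP; split=> [y [w _ Iy]|y [n [s [j [z Iy]]]]]; first by do 4 eexists; exact: Iy.
exists (npair (npair n s) (npair j z)) => //.
by rewrite /cover_lower /cover_upper !npairE.
Qed.

Lemma cover_lower_ge0 w : 0 <= code_val R (cover_lower w).
Proof. exact: lower_code_ge0. Qed.

Lemma cover_upper_le1 w : code_val R (cover_upper w) <= 1.
Proof. exact: upper_code_le1. Qed.

Lemma image_cover_sub : image_cover `<=` `[0, 1]%classic.
Proof.
move=> y [w _]; rewrite /= !in_itv /= => /andP[h1 h2].
by rewrite (le_trans (cover_lower_ge0 w)) ?(le_trans _ (cover_upper_le1 w)) // ltW.
Qed.

(** With radius 0 both ends would be squeezed to the centre; for z >= 3 the lower end is at least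
    1. *)
Let I_empty n s j z : ~~ isnew n s j \/ (3 <= z)%N -> I n s j z = set0.
Proof.
move=> h; apply/seteqP; split=> // y; rewrite /I /= in_itv /= => /andP[h1 h2].
have [isn|isn] := boolP (isnew n s j); last first.
  have := lower_code_ge R (V n s j) s (rho n s j) z.
  have := upper_code_le (lt_trans h1 h2).
  rewrite rhoE (negbTE isn) mul0r -/(lower n s j z) -/(upper n s j z).
  have := lt_trans h1 h2; lra.
case: h => [|z3]; first by rewrite isn.
have : (rho n s j <= den (V n s j) * 2 ^ s)%N.
  have := radius_le1 isn; have := rhoE n s j; rewrite isn mul1r => <-.
  by rewrite ler_pdivrMr ?mul1r ?ler_nat // ltr0n muln_gt0 expn_gt0.
move=> /(lower_code_ge1 R z3); have := upper_code_le1 R (V n s j) s (rho n s j) z.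
rewrite -/(lower n s j z) -/(upper n s j z).
have := lt_trans h1 h2; lra.
Qed.

Let mI n s j z : measurable (I n s j z). Proof. exact: measurable_itv. Qed.

Let E n s : set R := \big[setU/set0]_(j < 2 ^ s) \bigcup_z I n s j z.

Let mIz n s j : measurable (\bigcup_z I n s j z).
Proof. by apply: bigcup_measurable => z _; exact: mI. Qed.

Let mE n s : measurable (E n s).
Proof. by apply: bigsetU_measurable => j _; exact: mIz. Qed.

(** The constant 18 comes from 3 translates, each as long as 2 radii, with radius [3 * 2 ^ L n]
    times the length of the cell. *)
Let mu_E n s : (mu (E n s) <= (18 * 2 ^+ L n * new_size (A n) (B n) R s)%:E)%E.
Proof.
apply: le_trans; first exact: (@lebesgue_bigsetU_le R (fun j => \bigcup_z I n s j z)).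
rewrite /new_size natr_sum mulrA mulr_sumr mulr_suml -sumEFin.
apply: lee_sum => j _; apply: (@lebesgue_bigcup_le R _
  (fun z => if (z < 3)%N then 2 * ((isnew n s j)%:R * radius n s) else 0)) => //.
- move=> z; case: ltnP => z3; last by rewrite I_empty ?measure0 //; right.
  by rewrite -rhoE; exact: lebesgue_code_interval.
move=> N; rewrite -/(isnew n s j).
have r0 : 0 <= (isnew n s j)%:R * radius n s.
  by rewrite mulr_ge0 // /radius divr_ge0 ?mulr_ge0 ?exprn_ge0.
set q := 2 * _; have q0 : 0 <= q by rewrite mulr_ge0.
have {}q3 : \sum_(z < N) (if (z < 3)%N then q else 0) <= (minn N 3)%:R * q.
  elim: N => [|N ih]; first by rewrite big_ord0 mul0r.
  rewrite big_ord_recr /=; case: ltnP => N3.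
    rewrite (minn_idPl N3) -natr1 mulrDl mul1r lerD2r.
    by rewrite (minn_idPl (ltnW N3)) in ih.
  by rewrite addr0; apply: le_trans ih _; rewrite ler_wpM2r // ler_nat; lia.
apply: le_trans q3 _; apply: (@le_trans _ _ (3 * q)).
  by rewrite ler_wpM2r // ler_nat geq_minr.
by rewrite /q /radius; lra.
Qed.

(** The new cells beyond level K are controlled by telescoping and [level_size_window]. *)
Let mu_levels n K (w : R) : (mu (W n) <= w%:E)%E ->
  (mu (\bigcup_s E n (K + s).+1) <=
   (18 * 2 ^+ L n * (w - window_size (A n) (B n) R K))%:E)%E.
Proof.
move=> muw.
apply: lebesgue_bigcup_le (fun s => mu_E n (K + s).+1) _ => // N.
rewrite -mulr_sumr sum_new_size ler_pM2l ?mulr_gt0 ?exprn_gt0 //.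
exact: level_size_window muw.
Qed.

(** The case K = 0, with empty window. The Lipschitz factor cancels against [muW], whose 7 gives
    128; the bounds sum over n to less than 1/2. *)
Let mu_all_levels n : (mu (\bigcup_s E n s.+1) <= (18 / 128 * 2 ^- n)%:E)%E.
Proof.
have := mu_levels 0 (muW n); under eq_bigcupr do rewrite add0n.
move=> /le_trans; apply; rewrite lee_fin /window_size /window_count muln0 mul0n.
rewrite /cover_count big_ord0 mul0r subr0 !exprD !invfM.
have : 2 ^+ L n != 0 :> R by rewrite lt0r_neq0 // exprn_gt0.
move: (2 ^+ L n) (2 ^- n) => a b a0; rewrite (_ : 18 * a * _ = 18 / 128 * b) //.
by field.
Qed.

Lemma sum_exp2 N : \sum_(n < N) 2 ^- n <= 2 :> R.
Proof.
suff -> : \sum_(n < N) 2 ^- n = 2 - 2 * 2 ^- N :> R.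
  by rewrite gerBl mulr_ge0 // invr_ge0 exprn_ge0.
elim: N => [|N ih]; first by rewrite big_ord0 expr0 invr1; ring.
by rewrite big_ord_recr /= ih exprS invfM; lra.
Qed.

Let level_cover n s j z y : I n s j z y -> exists2 s', s = s'.+1 & E n s'.+1 y.
Proof.
have [isn|isn] := boolP (isnew n s j); last by rewrite I_empty; last by left.
move=> Iy; have js : (j < 2 ^ s)%N by case/and3P: isn.
case: s isn js Iy => [|s] isn js Iy.
  by move: isn; rewrite /isnew /new_cell /level covers0 andbF.
exists s => //; rewrite /E -(bigcup_mkord _ (fun j => \bigcup_z I n s.+1 j z)).
by exists j => //; exists z.
Qed.

Lemma lebesgue_image_cover : (mu image_cover <= (1 / 2)%:E)%E.
Proof.
have mF n : measurable (\bigcup_s E n s.+1) by apply: bigcup_measurable => s _; exact: mE.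
have SF : image_cover `<=` \bigcup_n \bigcup_s E n s.+1.
  rewrite image_coverE => y [n [s [j [z /level_cover [s' _ Ey]]]]].
  by exists n => //; exists s'.
apply: le_trans.
  apply: le_lebesgue SF; [exact: measurable_intervals|exact: bigcup_measurable].
apply: lebesgue_bigcup_le mu_all_levels _ => // N.
by rewrite -mulr_sumr; have := sum_exp2 N; lra.
Qed.

(** * Approximation of the cover by finite subunions *)

Section FinitePart.
Variable K : nat -> nat -> nat.
Hypothesis muK : forall n p, (mu (W n) <=
  (window_size (A n) (B n) R (K n p) + 3 * 2 ^- (n + L n + p + 8))%:E)%E.

Let Ksum p := (\sum_(n < p.+1) K n p)%N.

(** Exceeds every code with n <= p, s <= [Ksum p], j <= [2 ^ Ksum p] and z <= 2. The sum [Ksum p]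
    stands in for the maximum of the [K n p]. *)
Definition cover_bound (p : nat) : nat :=
  (npair (npair p (Ksum p)) (npair (2 ^ Ksum p) 2)).+1.

Lemma computable_cover_bound : computable2 K -> computable cover_bound.
Proof.
move=> cK; have cS : computable Ksum.
  by apply: (@computable_sum (fun p n => K n p)); computability.
by rewrite /cover_bound; computability.
Qed.

(** What the finite part misses comes from levels beyond [K n p] (in [G]) or from indices n > p (in
    [H]). Each contributes at most half of the error. *)
Lemma lebesgue_cover_bound p : (mu image_cover <=
  mu (\bigcup_(w < cover_bound p)
        `]code_val R (cover_lower w), code_val R (cover_upper w)[%classic) +
  (2 ^- p)%:E)%E.
Proof.
set F := \bigcup_(w < _) _.
pose G := \bigcup_n \bigcup_s E n (K n p + s).+1.
pose H := \bigcup_i \bigcup_s E (p.+1 + i) s.+1.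
have mF : measurable F by apply: bigcup_measurable => w _; exact: measurable_itv.
have mG1 n : measurable (\bigcup_s E n (K n p + s).+1).
  by apply: bigcup_measurable => s _; exact: mE.
have mG : measurable G by exact: bigcup_measurable.
have mH1 n : measurable (\bigcup_s E n s.+1).
  by apply: bigcup_measurable => s _; exact: mE.
have mH : measurable H by apply: bigcup_measurable => i _; exact: mH1.
have SFGH : image_cover `<=` F `|` (G `|` H).
  rewrite image_coverE => y [n [s [j [z Iy]]]].
  have [np|pn] := leqP n p; last first.
    right; right; have [s' _ Ey] := level_cover Iy; exists (n - p.+1)%N => //.
    by rewrite subnKC //; exists s'.
  have [sK|Ks] := leqP s (K n p); last first.
    right; left; have [s' ss' Ey] := level_cover Iy; exists n => //.
    by exists (s' - K n p)%N => //; rewrite subnKC //; move: Ks; rewrite ss'.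
  left; exists (npair (npair n s) (npair j z)); last first.
    by rewrite /cover_lower /cover_upper !npairE.
  have sS : (s <= Ksum p)%N.
    apply: leq_trans sK _; rewrite /Ksum.
    by rewrite (bigD1 (Ordinal (np : (n < p.+1)%N))) //= leq_addr.
  have [isn|isn] := boolP (isnew n s j); last by move: Iy; rewrite I_empty //; left.
  have [z3|z3] := leqP 3 z; first by move: Iy; rewrite I_empty //; right.
  have /and3P[js _ _] := isn.
  rewrite /= /cover_bound ltnS; do 2 apply: leq_npair => //.
  by apply: leq_trans (ltnW js) _; rewrite leq_exp2l.
apply: le_trans.
  apply: le_lebesgue SFGH; first exact: measurable_intervals.
  by apply: measurableU => //; exact: measurableU.
apply: le_trans; first by apply: lebesgue_setU_le => //; exact: measurableU.
apply: leeD => //.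
apply: le_trans; first exact: lebesgue_setU_le.
have muG : (mu G <= (2 ^- p / 2)%:E)%E.
  apply: (lebesgue_bigcup_le (d := fun n => 54 / 256 * 2 ^- p * 2 ^- n)) => //.
    move=> n; apply: le_trans; first exact: mu_levels (muK n p).
    rewrite lee_fin addrAC subrr add0r !exprD !invfM.
    have : 2 ^+ L n != 0 :> R by rewrite lt0r_neq0 // exprn_gt0.
    move: (2 ^+ L n) (2 ^- n) (2 ^- p) => a b c a0.
    by rewrite (_ : 18 * a * _ = 54 / 256 * c * b) //; field.
  move=> N; rewrite -mulr_sumr.
  have p0 : 0 < 2 ^- p :> R by rewrite invr_gt0 exprn_gt0.
  by have := sum_exp2 N; nra.
have muH : (mu H <= (2 ^- p / 2)%:E)%E.
  apply: (lebesgue_bigcup_le (d := fun i => 18 / 128 * 2 ^- p.+1 * 2 ^- i)) => //.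
    move=> i; apply: le_trans; first exact: mu_all_levels.
    by rewrite lee_fin exprD invfM mulrA.
  move=> N; rewrite -mulr_sumr exprS invfM.
  have p0 : 0 < 2 ^- p :> R by rewrite invr_gt0 exprn_gt0.
  by have := sum_exp2 N; nra.
apply: le_trans; first exact: leeD muG muH.
by rewrite -EFinD lee_fin; lra.
Qed.

End FinitePart.

(** * The images lie in the cover *)

Section Membership.
Variable u : nat -> R -> R.
Hypothesis lip : forall n s t, 0 <= s <= 1 -> 0 <= t <= 1 ->
  `|u n.+1 s - u n.+1 t| <= 2 ^+ L n * `|s - t|.
Hypothesis hV : forall n s j, (j < 2 ^ s)%N ->
  `|u n.+1 (grid R s 0 j) - code_val R (V n s j)| <= 2 ^- s.

(** The maximal closed cell about t has its left end within [2 ^- s] of t, so the value at t is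
    strictly within the radius of [V n s j]. A positive fractional part survives the cut to
    [0, 1]. *)
Lemma image_cover_mem n t : 0 <= t <= 1 -> W n t ->
  0 < frac_part (u n.+1 t) -> image_cover (frac_part (u n.+1 t)).
Proof.
move=> t01 Wt f0; have [s [j [isn tj]]] := new_cell_exists t01 Wt.
have /and3P[js _ _] := isn.
have Ln1 : 1 <= 2 ^+ L n :> R by rewrite exprn_ege1 // ler1n.
have s0 : 0 < 2 ^- s :> R by rewrite invr_gt0 exprn_gt0.
have near : `|u n.+1 t - code_val R (V n s j)| < radius n s.
  have g01 : 0 <= grid R s 0 j <= 1.
    rewrite /grid subr0 divr_ge0 ?exprn_ge0 //= ler_pdivrMr ?exprn_gt0 // mul1r.
    by rewrite -natrX ler_nat ltnW.
  have h1 := lip n t01 g01; have h2 := hV n js.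
  have h3 : `|t - grid R s 0 j| <= 2 ^- s.
    by move: tj; rewrite gridS => /andP[? ?]; rewrite ger0_norm; lra.
  have h4 : 2 ^+ L n * `|t - grid R s 0 j| <= 2 ^+ L n * 2 ^- s.
    by rewrite ler_wpM2l // ltW // (lt_le_trans ltr01).
  have h5 := ler_distD (u n.+1 (grid R s 0 j)) (u n.+1 t) (code_val R (V n s j)).
  rewrite /radius; move: (2 ^+ L n) (2 ^- s) Ln1 s0 h1 h2 h4 => a b *; nra.
have [z hz] := frac_part_near near (radius_le1 isn) f0.
have f1 : frac_part (u n.+1 t) < 1.
  by have := floorD1_gt (u n.+1 t); rewrite /frac_part intrD; lra.
rewrite image_coverE; exists n, s, j, z; rewrite /I /= in_itv /=.
have rE : (rho n s j)%:R / (den (V n s j) * 2 ^ s)%:R = radius n s.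
  by rewrite rhoE /isnew isn mul1r.
move: hz; rewrite ltr_norml => /andP[hz1 hz2]; apply/andP; split.
  by apply: lower_code_lt => //; rewrite rE; lra.
by apply: upper_code_gt => //; rewrite rE; lra.
Qed.

End Membership.
End ImageCover.

(** The first [T p] intervals nearly exhaust the measure, and the measure of a finite union is
    approximated by counting cells. *)
Lemma computable_real_intervals (R : realType) (A B T : nat -> nat) :
  computable A -> computable B -> computable T ->
  (forall k, 0 <= code_val R (A k)) -> (forall k, code_val R (B k) <= 1) ->
  (forall p, (lebesgue_measure (@intervals A B R) <=
     lebesgue_measure (\bigcup_(k < T p) `]code_val R (A k), code_val R (B k)[%classic) +
     (2 ^- p)%:E)%E) ->
  computable_real (fine (lebesgue_measure (@intervals A B R))).
Proof.
move=> cA cB cT A0 B1 hT.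
(* Omitting intervals costs [2 ^- p.+1]; as T <= 2^T, counting at resolution M costs at most
   [2 ^- p / 4]. *)
pose M p := (T p.+1 + p + 3)%N.
pose q p := npair (npair (cover_count A B (T p.+1) (M p) 0 (2 ^ M p)) 0) (2 ^ M p).-1.
exists (rat_of_code \o q) => [|p].
  exists q => //; rewrite /q /M; computability.
  by apply: (@computable_cover_count (fun=> A) (fun=> B)); computability.
rewrite /= -/(code_val R (q p)) code_valE /num1 /num2 /den /q !npairE subr0.
rewrite prednK ?expn_gt0 // natrX.
have [h1 h2] := lebesgue_cover_count (T p.+1) (M p) A0 B1.
have h3 := hT p.+1.
have h4 : (lebesgue_measure
    (\bigcup_(k < T p.+1) `]code_val R (A k), code_val R (B k)[%classic) <=
    lebesgue_measure (@intervals A B R))%E.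
  apply: le_lebesgue; last by move=> x [k _ xk]; exists k.
    by apply: bigcup_measurable => k _; exact: measurable_itv.
  exact: measurable_intervals.
move: h1 h2 h3 h4; move: (lebesgue_measure _) => m1; move: (lebesgue_measure _) => m2.
case: m1 m2 => [a| |] [b| |] //=; rewrite -?EFinD !lee_fin => h1 h2 h3 h4.
have hM : 2 * (T p.+1)%:R / 2 ^+ M p <= 2 ^- p / 4 :> R.
  rewrite /M !exprD !invfM.
  have : (T p.+1)%:R <= 2 ^+ T p.+1 :> R by rewrite -natrX ler_nat ltnW // ltn_expl.
  have : 0 < 2 ^+ T p.+1 :> R by rewrite exprn_gt0.
  have : 0 < 2 ^- p :> R by rewrite invr_gt0 exprn_gt0.
  move: (2 ^- p) (2 ^+ T p.+1) (T p.+1)%:R => x y t x0 y0 ty.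
  rewrite (_ : 2 * t * _ = t / y * (x / 4)); last by field; rewrite lt0r_neq0.
  by rewrite ger_pMl ?divr_gt0 // ler_pdivrMr // mul1r.
have p0 : 0 < 2 ^- p :> R by rewrite invr_gt0 exprn_gt0.
by move: h3; rewrite exprS invfM ler_norml => h3; apply/andP; split; lra.
Qed.

(** * The theorem *)

(** The constant oracle given by its code names a grid point exactly, so [oracle_free] yields an
    ordinary program. *)
Lemma computable_dyadic_values (R : realType) (u : nat -> R -> R) :
  computable_fun_seq u -> exists2 V : nat -> nat -> nat -> nat, computable3 V &
    forall n s j, (j < 2 ^ s)%N ->
      `|u n.+1 (grid R s 0 j) - code_val R (V n s j)| <= 2 ^- s.
Proof.
move=> [c hc].
(* Indices out of range are sent to 0, because halting is guaranteed only on [0, 1] and [V] has to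
   be total. *)
pose clip w := (nsnd (nsnd w) * (nsnd (nsnd w) < 2 ^ nfst (nsnd w)))%N.
pose point w := npair (npair (clip w) 0) (2 ^ nfst (nsnd w)).-1.
pose input w := npair (point w) (npair (nfst w).+1 (nfst (nsnd w))).
have pointE w : code_val R (point w) = grid R (nfst (nsnd w)) 0 (clip w).
  rewrite code_valE /num1 /num2 /den /point !npairE prednK ?expn_gt0 //.
  by rewrite /grid natrX.
have /choice [f hf] : forall w, exists v,
    run (fun=> 0%N) (oracle_free c) (input w) v /\
    `|u (nfst w).+1 (code_val R (point w)) - code_val R v| <= 2 ^- nfst (nsnd w).
  move=> w; have p01 : code_val R (point w) \in `[0, 1].
    rewrite pointE in_itv /= /grid subr0 divr_ge0 ?exprn_ge0 //=.
    rewrite ler_pdivrMr ?exprn_gt0 // mul1r -natrX ler_nat /clip.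
    by case: ltnP => [/ltnW|]; rewrite ?muln1 ?muln0.
  have [//|j|v rv hv] := hc (nfst w).+1 (nfst (nsnd w)) _ (fun=> point w) _ p01.
    by rewrite subrr normr0 invr_ge0 exprn_ge0.
  by exists v; split=> //; exact: run_oracle_free.
have [d hd] : computable input by rewrite /input /point /clip; computability.
exists (fun n s j => f (npair n (npair s j))).
  exists (Comp (oracle_free c) d) => w; rewrite !npairK /=.
  by exists (input w) => //; have [] := hf w.
move=> n s j js; have [_] := hf (npair n (npair s j)).
by rewrite pointE /clip !npairE js muln1.
Qed.

(** A rational (a - b) / (d + 1) is at most a, hence at most 2^a, so its first numerator serves as
    exponent. *)
Lemma lipschitz_exp2 (R : realType) (u : nat -> R -> R) :
  computably_Lipschitz u -> exists2 L : nat -> nat, computable L &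
    forall n s t, 0 <= s <= 1 -> 0 <= t <= 1 ->
      `|u n.+1 s - u n.+1 t| <= 2 ^+ L n * `|s - t|.
Proof.
move=> [l [g cg lg] hl]; exists (fun n => num1 (g n.+1)).
  by rewrite /num1; computability.
move=> n s t s01 t01; have [//|_ hn] := hl n.+1.
have := hn (s, t); rewrite /= !in_itv /= => /(_ (conj s01 t01)).
move=> /le_trans; apply; rewrite ler_wpM2r // lg -/(code_val R _) code_valE.
set v := g n.+1; apply: (@le_trans _ _ (num1 v)%:R).
  rewrite ler_pdivrMr ?ltr0n //; apply: (@le_trans _ _ (num1 v)%:R).
    by rewrite gerBl.
  by rewrite -natrM ler_nat leq_pmulr.
by rewrite -natrX ler_nat ltnW // ltn_expl.
Qed.

Definition code_le_dyadic (c N s : nat) : bool :=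
  (num1 c * 2 ^ s <= N * den c + num2 c * 2 ^ s)%N.

Lemma code_le_dyadicE (R : realType) c N s :
  code_le_dyadic c N s = (code_val R c <= N%:R / 2 ^+ s).
Proof.
rewrite code_valE ler_pdivrMr ?ltr0n // mulrAC ler_pdivlMr ?exprn_gt0 //.
by rewrite mulrBl lerBlDr -natrX -!natrM -natrD ler_nat.
Qed.

(** One set serves both parts of the theorem; the last clause gives the computable measure needed
    for Schnorr tests. *)
Lemma small_cover (R : realType) (u : nat -> R -> R) (U : nat -> set R) (x : R) :
  computable_fun_seq u -> computably_Lipschitz u -> 0 <= x <= 1 ->
  MartinLof_test U -> (forall n, U n x) ->
  exists S : set R,
    [/\ Sigma01 S, (lebesgue_measure S <= (1 / 2)%:E)%E,
        forall n, (1 <= n)%N -> 0 < frac_part (u n x) -> S (frac_part (u n x)) &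
        computable_real_seq (fun n => fine (lebesgue_measure (U n))) ->
        computable_real (fine (lebesgue_measure S))].
Proof.
move=> /computable_dyadic_values [V cV hV] /lipschitz_exp2 [L cL lip] x01.
move=> [[a [b [[ga cga aE] [gb cgb bE] UE]]] _ [g [[q [G cG qE] gq] Ug g0]]] xU.
have exp0 k : 0 < 2 ^- k :> R by rewrite invr_gt0 exprn_gt0.
have gE k i : `|g k - code_val R (G (npair k i))| <= 2 ^- i by rewrite /code_val -(qE k i).
(* With error e = [2 ^- (n + L n + 9)], an approximation of [g m] at most 2e is found since [g]
   tends to 0. Then [g m] <= 3e, below the required 4e. *)
have [||m cm hm] := @mu_search (fun n m =>
  code_le_dyadic (G (npair m (n + L n + 9))) 2 (n + L n + 9)).
- by rewrite /code_le_dyadic /num1 /num2 /den; computability.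
- move=> n; set k := (n + L n + 9)%N.
  have /cvgrPdist_lt /(_ _ (exp0 k)) [m _ /(_ m (leqnn m))] /= := g0.
  rewrite sub0r normrN ltr_norml => /andP[_ gm]; exists m.
  rewrite (code_le_dyadicE R); have := gE m k; rewrite ler_norml => /andP[h _].
  by have := exp0 k; lra.
have muW n : (lebesgue_measure (U (m n)) <= (2 ^- (n + L n + 7))%:E)%E.
  apply: le_trans (Ug _) _; rewrite lee_fin.
  have := hm n; rewrite (code_le_dyadicE R); have := gE (m n) (n + L n + 9)%N.
  rewrite ler_norml => /andP[_ h].
  have -> : 2 ^- (n + L n + 7) = 4 * 2 ^- (n + L n + 9) :> R.
    by rewrite !(exprD _ (n + L n)%N) !invfM; lra.
  by have := exp0 (n + L n + 9)%N; lra.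
pose A n k := ga (npair (m n) k); pose B n k := gb (npair (m n) k).
have WE n : U (m n) = @intervals (A n) (B n) R.
  by rewrite UE; apply: eq_bigcupr => k _; rewrite aE bE.
have cA : computable2 A by rewrite /A; computability.
have cB : computable2 B by rewrite /B; computability.
have muI n : (lebesgue_measure (@intervals (A n) (B n) R) <= (2 ^- (n + L n + 7))%:E)%E.
  by rewrite -WE.
have cl := computable_cover_lower cL cV cA cB.
have cu := computable_cover_upper cL cV cA cB.
exists (@image_cover R L V A B); split.
- split; first exact: image_cover_sub.
  exists (rat_of_code \o cover_lower L V A B), (rat_of_code \o cover_upper L V A B).
  by split=> //; [exists (cover_lower L V A B)|exists (cover_upper L V A B)].
- exact: lebesgue_image_cover.
- by move=> [//|n] _; apply: image_cover_mem => //; rewrite -WE.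
move=> [h [H cH hE] hU].
have hUE k i : `|fine (lebesgue_measure (U k)) - code_val R (H (npair k i))| <= 2 ^- i.
  by rewrite /code_val -(hE k i).
have muWE n : ((fine (lebesgue_measure (U (m n))))%:E = lebesgue_measure (U (m n)))%E.
  by apply: fineK; rewrite ge0_fin_numE ?measure_ge0 // (le_lt_trans (muW n)) ?ltry.
pose prec n p := (n + L n + p + 8)%N.
(* The computed measure is to be at most the window size plus twice the precision, both over the
   denominator [2 ^ (K + prec)]. Its own error makes this 3 in [muK]. *)
have [||K cK hK] := @mu_search (fun w K => code_le_dyadic
  (H (npair (m (nfst w)) (prec (nfst w) (nsnd w))))
  (window_count (A (nfst w)) (B (nfst w)) K * 2 ^ prec (nfst w) (nsnd w) + 2 * 2 ^ K)
  (K + prec (nfst w) (nsnd w))).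
- rewrite /code_le_dyadic /num1 /num2 /den /prec /window_count; computability.
  by apply: (@computable_cover_count (fun w => A (nfst (nfst w)))
    (fun w => B (nfst (nfst w)))); computability.
- move=> w; set n := nfst w; set k := prec _ _.
  have [K hK] := window_size_cvg (muI n) (exp0 k); exists K.
  rewrite (code_le_dyadicE R) natrD !natrM !natrX exprD.
  have := hUE (m n) k; rewrite ler_norml => /andP[h1 _].
  move: hK; rewrite -WE -muWE lee_fin /window_size => hK.
  rewrite (_ : _ / _ = (window_count (A n) (B n) K)%:R / 2 ^+ K + 2 * 2 ^- k); first lra.
  by field; rewrite !lt0r_neq0 // exprn_gt0.
have muK n p : (lebesgue_measure (@intervals (A n) (B n) R) <=
    (window_size (A n) (B n) R (K (npair n p)) + 3 * 2 ^- (n + L n + p + 8))%:E)%E.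
  rewrite -WE -muWE lee_fin; have := hK (npair n p); rewrite !npairE.
  rewrite (code_le_dyadicE R) natrD !natrM !natrX exprD -/(prec n p).
  have := hUE (m n) (prec n p); rewrite ler_norml => /andP[_ h1].
  move: (K _) => N; rewrite /window_size.
  rewrite (_ : (_ + _) / _ = (window_count (A n) (B n) N)%:R / 2 ^+ N +
    2 * 2 ^- prec n p); first lra.
  by field; rewrite !lt0r_neq0 // exprn_gt0.
apply: (@computable_real_intervals R (cover_lower L V A B) (cover_upper L V A B)
  (cover_bound (fun n p => K (npair n p)))) => //.
- by apply: computable_cover_bound; computability.
- exact: cover_lower_ge0.
- exact: cover_upper_le1.
- by move=> p; exact: lebesgue_cover_bound.
Qed.

(** The reference set for frequencies: it excludes fractional part 0, which no open subset of [0, 1]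
    contains. *)
Lemma Schnorr_Sigma01_itv01 (R : realType) : @Schnorr_Sigma01 R `]0, 1[%classic.
Proof.
have c k : computable_rat_seq (fun=> rat_of_code k).
  by exists (fun=> k) => //; exact: computable_const.
split; [split=> [x|]|].
- by rewrite /= !in_itv /= => /andP[? ?]; rewrite !ltW.
- exists (fun=> rat_of_code (npair (npair 0 0) 0)),
    (fun=> rat_of_code (npair (npair 1 0) 0)).
  split=> //; rewrite -/(code_val R _) -/(code_val R _) !code_valE /num1 /num2 /den !npairE.
  by rewrite !subr0 !divr1 bigcup_const //; exists 0%N.
exists (fun=> rat_of_code (npair (npair 1 0) 0)) => // k.
rewrite -/(code_val R _) code_valE /num1 /num2 /den !npairE subr0 divr1.
by rewrite lebesgue_itv_le // subr0 subrr normr0 invr_ge0 exprn_ge0.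
Qed.

(** Each index counted for (0, 1) is counted for [S], so the limit frequencies would give 1 <=
    1/2. *)
Lemma ud_small_cover (R : realType) (C : set (set R)) (y : nat -> R) (S : set R) :
  ud C y -> C `]0, 1[%classic -> C S -> (lebesgue_measure S <= (1 / 2)%:E)%E ->
  (forall n, (1 <= n)%N -> 0 < frac_part (y n) -> S (frac_part (y n))) -> False.
Proof.
move=> hud C01 CS muS Sy.
have h01 := hud _ C01; have hS := hud _ CS.
have : (lebesgue_measure (`]0%R, 1%R[%classic : set R) <= lebesgue_measure S)%E.
  rewrite -(cvg_lim _ h01) // -(cvg_lim _ hS) //.
  apply: lee_lim; [by apply: cvgP h01|by apply: cvgP hS|].
  apply: nearW => N; rewrite lee_fin ler_wpM2r ?invr_ge0 // ler_nat.
  rewrite [leqLHS]big_nat_cond [leqRHS]big_nat_cond big_mkcond.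
  rewrite [leqRHS]big_mkcond /=; apply: leq_sum => n _.
  case: ifP => // /andP[/andP[n1 ->] /set_mem]; rewrite /= in_itv /= => /andP[y0 _].
  by rewrite n1 mem_set //; exact: Sy.
rewrite lebesgue_itv_le // => /le_trans /(_ muS); rewrite lee_fin; lra.
Qed.

Theorem theorem2 (R : realType) (u : nat -> R -> R)
    (hu : computable_fun_seq u) (hlip : computably_Lipschitz u)
    (x : R) (hx : x \in `[0, 1]) :
  (ud (@Sigma01 R) (fun n => u n x) -> MartinLof_random x) /\
  (ud (@Schnorr_Sigma01 R) (fun n => u n x) -> Schnorr_random x).
Proof.
have x01 : 0 <= x <= 1 by move: hx; rewrite in_itv.
have [S01 cS01] := Schnorr_Sigma01_itv01 R.
split=> [hud U tU xU|hud U [tU cU] xU].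
  have [S [SS muS Sx _]] := small_cover hu hlip x01 tU xU.
  exact: (ud_small_cover hud S01 SS muS Sx).
have [S [SS muS Sx /(_ cU) cS]] := small_cover hu hlip x01 tU xU.
exact: (ud_small_cover hud (conj S01 cS01) (conj SS cS) muS Sx).
Qed.
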